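(* There exists a contractible 2-complex $X$ which has neither non-positive immersions nor weak non-positive immersions.
   Context: All complexes are CW-complexes and all morphisms of complexes are assumed to be combinatorial, i.e. they send $n$-cells homeomorphically to $n$-cells. A map $Y\to X$ of CW-complexes is an immersion, written $Y\looparrowright X$, if it is locally injective. $\chi$ denotes the Euler characteristic. A 2-complex $X$ has non-positive immersions (NPI) if for every immersion $Y\looparrowright X$ of a compact, connected 2-complex $Y$ into $X$, either $\chi(Y)\le 0$ or $\pi_1 Y=1$. A 2-complex $X$ has weak non-positive immersions (WNPI) if $\chi(Y)\le 1$ for every immersion $Y\looparrowright X$ of a compact, connected 2-complex $Y$ into $X$. *)

(* Defs.v *)
From HB Require Import structures.
From mathcomp Require Import all_boot all_order all_algebra finmap.
From mathcomp Require Import all_classical all_reals all_analysis.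

Set Implicit Arguments.
Unset Strict Implicit.
Unset Printing Implicit Defensive.

Import Order.TTheory GRing.Theory Num.Theory.
Import numFieldNormedType.Exports.

Local Open Scope classical_set_scope.
Local Open Scope ring_scope.

(* The norm of 'rV[R]_n in the library is the sup norm (with the same
   topology), whence the explicit Euclidean norm. *)
Definition sqnorm (R : realType) (n : nat) (x : 'rV[R]_n) : R :=
  \sum_(i < n) x ord0 i ^+ 2.

(* For n = 0 both discs are the one-point space and the sphere is empty. *)
Definition disc (R : realType) (n : nat) : set 'rV[R]_n :=
  [set x | sqnorm x <= 1].
Definition open_disc (R : realType) (n : nat) : set 'rV[R]_n :=
  [set x | sqnorm x < 1].
Definition sphere (R : realType) (n : nat) : set 'rV[R]_n :=
  [set x | sqnorm x = 1].
Arguments disc : clear implicits.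
Arguments open_disc : clear implicits.
Arguments sphere : clear implicits.

(* f restricts to a homeomorphism from A onto B, for the subspace topologies;
   continuity of the inverse is stated as openness. *)
Definition homeo_on (S T : topologicalType) (A : set S) (B : set T)
    (f : S -> T) : Prop :=
  {within A, continuous f} /\ set_bij A B f /\
  (forall V : set S, open V ->
     exists2 W : set T, open W & f @` (A `&` V) = B `&` W).

(* A CW structure on a Hausdorff space, given by characteristic maps: their
   restrictions to the open discs are homeomorphisms onto the open cells, which
   partition the space; the boundary of every cell lies in finitely many open
   cells of smaller dimension; the space has the weak topology (discs being
   closed, "closed in the disc" is "closed").  Only the values of a
   characteristic map on the disc are meaningful. *)
Record cwComplex (R : realType) := CWComplex {
  cw_space :> topologicalType;
  cell : nat -> choiceType;
  char_map : forall n, cell n -> 'rV[R]_n -> cw_space;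
  open_cell := fun d : {n : nat & cell n} =>
    char_map (projT2 d) @` open_disc R (projT1 d);
  cw_hausdorff : hausdorff_space cw_space;
  char_map_continuous : forall n (c : cell n),
    {within disc R n, continuous (char_map c)};
  char_map_homeo : forall n (c : cell n),
    homeo_on (open_disc R n) (char_map c @` open_disc R n) (char_map c);
  open_cell_disjoint : trivIset [set: {n : nat & cell n}] open_cell;
  open_cell_cover : \bigcup_d open_cell d = [set: cw_space];
  cw_closure_finite : forall n (c : cell n),
    exists F : set {m : nat & cell m},
      [/\ finite_set F,
          forall d, F d -> (projT1 d < n)%N
        & char_map c @` sphere R n `<=` \bigcup_(d in F) open_cell d];
  cw_weak_topology : forall A : set cw_space,
    (forall n (c : cell n), closed (disc R n `&` char_map c @^-1` A)) ->
    closed A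
}.

(* As usual, a graph also counts as a 2-complex: "dimension at most 2". *)
Record complex2 (R : realType) := Complex2 {
  cw_of_complex2 :> cwComplex R;
  complex2_dim : forall n, (2 < n)%N -> cell cw_of_complex2 n -> False
}.

Definition combinatorial (R : realType) (Y X : cwComplex R) (f : Y -> X)
    : Prop :=
  continuous f /\
  forall n (c : cell Y n), exists d : cell X n,
    homeo_on (open_cell (existT _ n c)) (open_cell (existT _ n d)) f.

Definition locally_injective (S T : topologicalType) (f : S -> T) : Prop :=
  forall s : S, exists2 U : set S, nbhs s U & set_inj U f.

Definition immersion (R : realType) (Y X : cwComplex R) (f : Y -> X) : Prop :=
  combinatorial f /\ locally_injective f.

(* Only meaningful for complexes with finitely many cells, e.g. compact ones:
   fset_set is empty on infinite sets. *)
Definition euler_char (R : realType) (Y : complex2 R) : int :=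
  \sum_(n < 3) (-1) ^+ n * (#|` fset_set [set: cell Y n]|)%:Z.

Definition unit_interval (R : realType) : set R := `[0, 1]%classic.
Arguments unit_interval : clear implicits.

Definition contractible (R : realType) (T : topologicalType) : Prop :=
  exists (x0 : T) (H : T * R -> T),
    [/\ {within [set: T] `*` unit_interval R, continuous H},
        forall x, H (x, 0) = x
      & forall x, H (x, 1) = x0].

(* A loop is represented by a function on R, of which only the restriction to
   [0, 1] matters. *)
Definition loop (R : realType) (T : topologicalType) (x : T) : set (R -> T) :=
  [set g | [/\ {within unit_interval R, continuous g}, g 0 = x & g 1 = x]].

Definition loop_homotopic (R : realType) (T : topologicalType) (x : T)
    (g h : R -> T) : Prop :=
  exists H : R * R -> T,
    [/\ {within unit_interval R `*` unit_interval R, continuous H},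
        forall s : R, unit_interval R s -> H (s, 0) = g s,
        forall s : R, unit_interval R s -> H (s, 1) = h s
      & forall t : R, unit_interval R t -> H (0, t) = x /\ H (1, t) = x].

Definition loop_class (R : realType) (T : topologicalType) (x : T)
    (g : R -> T) : set (R -> T) :=
  [set h | loop x h /\ loop_homotopic x g h].

(* The underlying set of the fundamental group at x. *)
Definition pi1 (R : realType) (T : topologicalType) (x : T)
    : set (set (R -> T)) :=
  [set loop_class x g | g in @loop R T x].

Definition pi1_trivial (R : realType) (T : topologicalType) : Prop :=
  forall x : T, @pi1 R T x = [set loop_class x (fun=> x)].

Definition NPI (R : realType) (X : complex2 R) : Prop :=
  forall (Y : complex2 R) (f : Y -> X),
    immersion f -> compact [set: Y] -> connected [set: Y] ->
    euler_char Y <= 0 \/ pi1_trivial R Y.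

Definition WNPI (R : realType) (X : complex2 R) : Prop :=
  forall (Y : complex2 R) (f : Y -> X),
    immersion f -> compact [set: Y] -> connected [set: Y] ->
    euler_char Y <= 1.

(* Main.v *)
Require Import Defs.
From HB Require Import structures.
From mathcomp Require Import all_boot all_order all_algebra finmap.
From mathcomp Require Import all_classical all_reals all_analysis.
From mathcomp Require Import ring lra.

Set Implicit Arguments.
Unset Strict Implicit.
Unset Printing Implicit Defensive.

Import Order.TTheory GRing.Theory Num.Theory.
Import numFieldNormedType.Exports.

Local Open Scope classical_set_scope.
Local Open Scope ring_scope.

(** The counterexample X is the abalone, the presentation complex of
    <a, b | a, aba = bb>.  It is a spine of the 3-ball, and the link of its only
    vertex is the complete graph K4 drawn on the 2-sphere.  Take the boundary
    sphere of a small neighbourhood of X in the ball and push it onto X: every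
    face is covered twice, once from each side, and the map is an immersion
    because the four regions of K4 in the 2-sphere are embedded triangles.

    Combinatorially, this sphere has vertices 0, 1, 2, 3, edges b from 0 to 1 to 2
    to 3, edges a from 0 to 0, from 1 to 2 and from 3 to 3, and each of the two
    relators closes up at two vertices: Euler characteristic 4 - 6 + 4 = 2, which
    is not allowed by WNPI.  No edge b leaves 3 and none enters 0, so an edge b
    from 3 to 0 may be added without losing the immersion; the Euler characteristic
    is now 1 and the fundamental group is infinite cyclic, against NPI
    ([sphere_immersion], [sphere_euler]).

    That an immersion is what the combinatorics promises rests on a criterion
    ([realize_locally_injective]): a cellular map that respects characteristic maps
    is locally injective as soon as two different cells with the same image never
    send a point of the closed disc to the same place.  By compactness of the
    discs, pairs of distinct points with the same image then stay away from the
    diagonal.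

    X is contractible because killing a turns aba = bb into b = bb.  The identity
    of X is deformed into a map that factors through the plane: [unroll] maps the
    plane to X by the face W on the unit disc, by collars on which the letters a of
    the boundary of W are pushed across the face A and then the loop b(bb)^-1, of
    degree -1 along b, is turned into a single loop, and by that loop b outside the
    disc of radius 3; [flat] maps X back to the plane.  The homotopy [slide] from
    the identity to their composite reparametrizes the radius ([unroll_flat],
    [abalone_contractible]).

    The loop through the additional edge is essential because collapsing the sphere
    maps it to a circle, where it has winding number 1; the winding number is
    computed as a finite sum of small angles ([loop_essential], [sphere_pi1]). *)

(** * Continuity of functions given by formulas *)

Section Continuity.
Context {R : realType}.
Implicit Types S T U : topologicalType.

Lemma cont_comp S T U (f : S -> T) (g : T -> U) :
  continuous f -> continuous g -> continuous (fun x => g (f x)).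
Proof. by move=> cf cg x; apply: continuous_comp; [exact: cf | exact: cg]. Qed.

Lemma cont_pair S T U (f : S -> T) (g : S -> U) :
  continuous f -> continuous g -> continuous (fun x => (f x, g x)).
Proof. by move=> cf cg x; apply: cvg_pair; [exact: cf | exact: cg]. Qed.

Lemma cont_comp2 S T U (V' : topologicalType) (f : S -> T) (g : S -> U) (h : T -> U -> V') :
  continuous (fun p : T * U => h p.1 p.2) ->
  continuous f -> continuous g -> continuous (fun x => h (f x) (g x)).
Proof.
move=> ch cf cg.
exact: (@cont_comp _ _ _ (fun x => (f x, g x)) (fun p => h p.1 p.2) (cont_pair cf cg) ch).
Qed.

Lemma cont_cst S T (a : T) : continuous (fun _ : S => a).
Proof. by move=> x; exact: cvg_cst. Qed.

Lemma cont_id S : continuous (fun x : S => x).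
Proof. by move=> x; exact: cvg_id. Qed.

Lemma cont_fst T U : continuous (fun p : T * U => p.1).
Proof. by move=> x; exact: cvg_fst. Qed.

Lemma cont_snd T U : continuous (fun p : T * U => p.2).
Proof. by move=> x; exact: cvg_snd. Qed.

Section Real.
Variable S : topologicalType.
Implicit Types f g : S -> R.

Lemma contD f g : continuous f -> continuous g -> continuous (fun x => f x + g x).
Proof. by move=> cf cg x; apply: cvgD; [exact: cf | exact: cg]. Qed.

Lemma contN f : continuous f -> continuous (fun x => - f x).
Proof. by move=> cf x; apply: cvgN; exact: cf. Qed.

Lemma contM f g : continuous f -> continuous g -> continuous (fun x => f x * g x).
Proof. by move=> cf cg x; apply: cvgM; [exact: cf | exact: cg]. Qed.

Lemma contX f n : continuous f -> continuous (fun x => f x ^+ n).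
Proof.
move=> cf; elim: n => [|n IH]; first exact: cont_cst.
under [X in continuous X]funext => x do rewrite exprS.
exact: contM.
Qed.

Lemma contV f : (forall x, f x != 0) -> continuous f -> continuous (fun x => (f x)^-1).
Proof. by move=> f0 cf x; apply: cvgV => //; exact: cf. Qed.

Lemma cont_max f g : continuous f -> continuous g ->
  continuous (fun x => Num.max (f x) (g x)).
Proof. by move=> cf cg x; apply: (@continuous_max R S f g); [exact: cf | exact: cg]. Qed.

Lemma cont_min f g : continuous f -> continuous g ->
  continuous (fun x => Num.min (f x) (g x)).
Proof. by move=> cf cg x; apply: (@continuous_min R S f g); [exact: cf | exact: cg]. Qed.

Lemma cont_sqrt f : continuous f -> continuous (fun x => Num.sqrt (f x)).
Proof. by move=> cf; apply: (cont_comp cf); exact: sqrt_continuous. Qed.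

Lemma cont_cos f : continuous f -> continuous (fun x => cos (f x)).
Proof. by move=> cf; apply: (cont_comp cf); exact: continuous_cos. Qed.

Lemma cont_sin f : continuous f -> continuous (fun x => sin (f x)).
Proof. by move=> cf; apply: (cont_comp cf); exact: continuous_sin. Qed.

Lemma cont_sum (I : Type) (r : seq I) (F : I -> S -> R) :
  (forall i, continuous (F i)) -> continuous (fun x => \sum_(i <- r) F i x).
Proof.
move=> cF; elim: r => [|i r IH].
  by rewrite (_ : (fun x => _) = fun=> 0); [exact: cont_cst|apply/funext => x; rewrite big_nil].
rewrite (_ : (fun x => _) = fun x => F i x + \sum_(j <- r) F j x); first exact: contD.
by apply/funext => x; rewrite big_cons.
Qed.

End Real.

Lemma closed_sublevel S (u : S -> R) (a : R) : continuous u -> closed [set x | u x <= a].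
Proof. by move=> cu; apply: (@preimage_closed _ _ u [set y | y <= a]) => [x _|]; [exact: cu|exact: closed_le]. Qed.

Lemma open_sublevel S (u : S -> R) (a : R) : continuous u -> open [set x | u x < a].
Proof. by move=> cu; apply: (@open_comp _ _ u [set y | y < a]) => [x _|]; [exact: cu|exact: open_lt]. Qed.

Lemma within_continuousT S T (f : S -> T) (A : set S) :
  A = setT -> {within A, continuous f} -> continuous f.
Proof.
move=> -> cf x U Ux; have := cf x U Ux; rewrite nbhs_simpl /=.
by rewrite nbhs_subspaceT.
Qed.

Lemma cont_if S T (u : S -> R) (f g : S -> T) :
  continuous u -> continuous f -> continuous g ->
  (forall x, u x = 0 -> f x = g x) ->
  continuous (fun x => if u x <= 0 then f x else g x).
Proof.
move=> cu cf cg fg.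
apply: (@within_continuousT _ _ _ ([set x | u x <= 0] `|` [set x | - u x <= 0])).
  rewrite predeqE => x; split=> //= _; rewrite oppr_le0.
  by case: (lerP (u x) 0) => [|/ltW]; [left|right].
apply: withinU_continuous.
- exact: closed_sublevel.
- by apply: closed_sublevel; exact: contN.
- apply: (@subspace_eq_continuous _ _ _ f); last exact: continuous_subspaceT.
  by move=> x /set_mem ux; rewrite /from_subspace /= ux.
- apply: (@subspace_eq_continuous _ _ _ g); last exact: continuous_subspaceT.
  move=> x /set_mem /=; rewrite oppr_le0 /from_subspace /= => u0.
  by case: (lerP (u x) 0) => // u0'; rewrite fg //; apply/eqP; rewrite eq_le u0 u0'.
Qed.

End Continuity.

Ltac cont_step := first [ assumption | lazymatch goal with
  | |- forall x, continuous_at x (fun y => y) => exact: cont_id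
  | |- forall x, continuous_at x (fun y => y.1) => exact: cont_fst
  | |- forall x, continuous_at x (fun y => y.2) => exact: cont_snd
  | |- forall x, continuous_at x fst => exact: cont_fst
  | |- forall x, continuous_at x snd => exact: cont_snd
  | |- forall x, continuous_at x (fun y => (_, _)) => apply: cont_pair
  | |- forall x, continuous_at x (fun y => _ + _) => apply: contD
  | |- forall x, continuous_at x (fun y => - _) => apply: contN
  | |- forall x, continuous_at x (fun y => _ * _) => apply: contM
  | |- forall x, continuous_at x (fun y => _ ^+ _) => apply: contX
  | |- forall x, continuous_at x (fun y => Num.max _ _) => apply: cont_max
  | |- forall x, continuous_at x (fun y => Num.min _ _) => apply: cont_min
  | |- forall x, continuous_at x (fun y => Num.sqrt _) => apply: cont_sqrt
  | |- forall x, continuous_at x (fun y => cos _) => apply: cont_cos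
  | |- forall x, continuous_at x (fun y => sin _) => apply: cont_sin
  | |- forall x, continuous_at x (fun y => ?f (fst y)) => apply: (cont_comp (@cont_fst _ _) (g := f))
  | |- forall x, continuous_at x (fun y => ?f (snd y)) => apply: (cont_comp (@cont_snd _ _) (g := f))
  | |- forall x, continuous_at x (fun y => ?c) => first [exact: cont_cst | by move=> ?; exact: cvg_cst]
  | |- forall x, continuous_at x (@GRing.opp _) => exact: (contN (@cont_id _))
  | |- forall x, continuous_at x (Order.max ?a) => exact: (cont_max (@cont_cst _ _ a) (@cont_id _))
  | |- forall x, continuous_at x (Order.min ?a) => exact: (cont_min (@cont_cst _ _ a) (@cont_id _))
  | |- forall x, continuous_at x (GRing.add ?a) => exact: (contD (@cont_cst _ _ a) (@cont_id _))
  | |- forall x, continuous_at x (GRing.mul ?a) => exact: (contM (@cont_cst _ _ a) (@cont_id _))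
  end ].
Ltac cont := repeat cont_step.

Section Cover.
Context {R : realType}.

(** Closed regions cut out by signs of two functions: inside a disc, and the
    lower and upper halves of its complement. *)
Lemma cont_glue (S T : topologicalType) (u v : S -> R) (h f1 f2 f3 : S -> T) :
  continuous u -> continuous v -> continuous f1 -> continuous f2 -> continuous f3 ->
  (forall x, u x <= 0 -> h x = f1 x) ->
  (forall x, 0 <= u x -> v x <= 0 -> h x = f2 x) ->
  (forall x, 0 <= u x -> 0 <= v x -> h x = f3 x) -> continuous h.
Proof.
move=> cu cv c1 c2 c3 h1 h2 h3.
pose A := [set x | u x <= 0].
pose B := [set x | - u x <= 0] `&` [set x | v x <= 0].
pose C := [set x | - u x <= 0] `&` [set x | - v x <= 0].
have cA : closed A by exact: closed_sublevel.
have cB : closed B by apply: closedI; apply: closed_sublevel; cont.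
have cC : closed C by apply: closedI; apply: closed_sublevel; cont.
have part (D : set S) (f : S -> T) : continuous f -> (forall x, D x -> h x = f x) ->
    {within D, continuous h}.
  move=> cf hf; apply: (@subspace_eq_continuous _ _ _ f); last exact: continuous_subspaceT.
  by move=> x /set_mem Dx; rewrite /from_subspace /= hf.
apply: (@within_continuousT _ _ _ (A `|` (B `|` C))).
  rewrite predeqE => x; split=> //= _; rewrite /A /B /C /= !oppr_le0.
  case: (lerP (u x) 0) => [|/ltW ux]; [by left|right].
  by case: (lerP (v x) 0) => [|/ltW] vx; [left|right].
apply: withinU_continuous => //; first exact: closedU.
  exact: part.
apply: withinU_continuous => //.
  by apply: part c2 _ => x [/=]; rewrite oppr_le0 => ? ?; exact: h2.
by apply: part c3 _ => x [/=]; rewrite !oppr_le0 => ? ?; exact: h3.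
Qed.

End Cover.

(** * Edge paths and boundaries of bigons *)

Section Walk.
Context {R : realType} {E : Type}.

(** The path that follows the edges [es] one after the other, each in unit
    time; [eps e] is the path along [e], and [p] is where an empty walk stays.
    Keeping the target type abstract lets the same walk be pushed forward by
    any map or homotopy. *)
Fixpoint walk {T : Type} (eps : E -> R -> T) (p : T) (es : seq E) (u : R) : T :=
  if es is e :: es' then if u - 1 <= 0 then eps e u else walk eps (eps e 1) es' (u - 1)
  else p.

Fixpoint linked {T : Type} (eps : E -> R -> T) (p : T) (es : seq E) : Prop :=
  if es is e :: es' then eps e 0 = p /\ linked eps (eps e 1) es' else True.

Definition walk_end {T : Type} (eps : E -> R -> T) (p : T) (es : seq E) : T :=
  foldl (fun _ e => eps e 1) p es.

Lemma walk_map (T U : Type) (g : T -> U) (eps : E -> R -> T) p es u :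
  g (walk eps p es u) = walk (fun e s => g (eps e s)) (g p) es u.
Proof. by elim: es p u => //= e es IH p u; case: ifP. Qed.

Lemma linked_map (T U : Type) (g : T -> U) (eps : E -> R -> T) p es :
  linked eps p es -> linked (fun e s => g (eps e s)) (g p) es.
Proof. by elim: es p => //= e es IH p [<- /IH]. Qed.

Lemma walk0 (T : Type) (eps : E -> R -> T) p es : linked eps p es -> walk eps p es 0 = p.
Proof. by case: es => //= e es [<- _]; rewrite sub0r oppr_le0 ler01. Qed.

Lemma walk_size (T : Type) (eps : E -> R -> T) p es :
  linked eps p es -> walk eps p es (size es)%:R = walk_end eps p es.
Proof.
elim: es p => //= e es IH p [_ l]; rewrite -natr1 addrK /walk_end /= -/(walk_end _ _ _) -IH //.
by case: es {IH} l => [|e' es] l; [rewrite /= lexx add0r|rewrite lern0].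
Qed.

Lemma walk_cont (S T : topologicalType) (eps : S -> E -> R -> T) es (p : S -> T) (u : S -> R) :
  (forall e, continuous (fun su : S * R => eps su.1 e su.2)) ->
  continuous p -> continuous u -> (forall s, linked (eps s) (p s) es) ->
  continuous (fun s => walk (eps s) (p s) es (u s)).
Proof.
move=> ce; elim: es p u => [|e es IH] p u cp cu l //=.
have ceu v : continuous v -> continuous (fun s => eps s e (v s)).
  by move=> cv; exact: (@cont_comp2 _ _ _ _ id v (fun s r => eps s e r) (ce e) (@cont_id _) cv).
apply: cont_if.
- by cont.
- exact: ceu.
- apply: IH; [exact/ceu/cont_cst | by cont | by move=> s; have [] := l s].
- move=> s us; rewrite us walk0; last by have [] := l s.
  by rewrite -[u s](subrK 1) us add0r.
Qed.

End Walk.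

Section Polar.
Context {R : realType}.

Definition rad (z : R * R) : R := Num.sqrt (z.1 ^+ 2 + z.2 ^+ 2).

Lemma rad_cont (S : topologicalType) (f : S -> R * R) : continuous f -> continuous (fun x => rad (f x)).
Proof.
move=> cf; have c1 := cont_comp cf (@cont_fst _ _); have c2 := cont_comp cf (@cont_snd _ _).
by rewrite /rad; cont.
Qed.

Lemma rad_ge0 z : 0 <= rad z. Proof. exact: sqrtr_ge0. Qed.

Lemma sqr_rad z : rad z ^+ 2 = z.1 ^+ 2 + z.2 ^+ 2.
Proof. by rewrite sqr_sqrtr // addr_ge0 ?sqr_ge0. Qed.

Lemma rad_lt1 z : (rad z < 1) = (z.1 ^+ 2 + z.2 ^+ 2 < 1).
Proof. by rewrite -sqr_rad -[X in _ = (_ < X)](expr1n _ 2) ltr_sqr ?nnegrE ?rad_ge0. Qed.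

Lemma radZ (a : R) z : 0 <= a -> rad (a *: z) = a * rad z.
Proof.
move=> a0; rewrite /rad /= !exprMn -mulrDr sqrtrM ?sqr_ge0 // sqrtr_sqr.
by rewrite ger0_norm.
Qed.

(** Abscissa of the radial projection to the unit circle. A positive [c] makes
    it continuous at the origin without changing it beyond radius [c]. *)
Definition dirx (c : R) (z : R * R) : R := z.1 / Num.max c (rad z).

Lemma dirx_cont (S : topologicalType) (c : R) (f : S -> R * R) : 0 < c ->
  continuous f -> continuous (fun x => dirx c (f x)).
Proof.
move=> c0 cf; have c1 := cont_comp cf (@cont_fst _ _); have c2 := rad_cont cf.
rewrite /dirx; apply: contM => //; apply: contV; last by cont.
by move=> x; rewrite gt_eqF // lt_max c0.
Qed.

Lemma dirx_ge (c : R) z : c <= rad z -> dirx c z = dirx 0 z.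
Proof. by move=> cz; rewrite /dirx (max_r cz) max_r // rad_ge0. Qed.

Lemma dirxZ (a : R) z : 0 < a -> dirx 0 (a *: z) = dirx 0 z.
Proof.
move=> a0; rewrite /dirx radZ 1?ltW // -{1}(mulr0 a) -maxr_pMr ?ltW //=.
by rewrite -mulf_div divff ?mul1r ?gt_eqF.
Qed.

Lemma dirx_axis c z : 0 < c -> c <= rad z -> z.2 = 0 -> dirx c z = 1 \/ dirx c z = -1.
Proof.
move=> c0 cz z2; have r0 : 0 < rad z by exact: lt_le_trans cz.
rewrite /dirx (max_r cz).
have -> : rad z = `|z.1| by rewrite /rad z2 expr0n addr0 sqrtr_sqr.
have [z1|z1|z1] := ltgtP 0 z.1.
- by left; rewrite gtr0_norm // divff // gt_eqF.
- by right; rewrite ltr0_norm // invrN mulrN divff // lt_eqF.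
- by move: r0; rewrite /rad -z1 z2 expr0n addr0 sqrtr0 ltxx.
Qed.

Lemma dirx_unit z : rad z = 1 -> dirx 0 z = z.1.
Proof. by move=> r; rewrite /dirx r max_r ?divr1 // ler01. Qed.

Lemma dirx_bound z : -1 <= dirx 0 z <= 1.
Proof.
rewrite /dirx max_r ?rad_ge0 //; have [r0|r0] := eqVneq (rad z) 0.
  by rewrite r0 invr0 mulr0 oppr_le0 ler01 /=.
have rp : 0 < rad z by rewrite lt_neqAle eq_sym r0 rad_ge0.
have : `|z.1| <= rad z.
  by rewrite -sqrtr_sqr /rad ler_sqrt ?addr_ge0 ?sqr_ge0 // lerDl sqr_ge0.
by rewrite ler_norml => /andP[h1 h2]; rewrite ler_pdivlMr // ler_pdivrMr // mulN1r mul1r h1.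
Qed.

(** A loop on the unit circle given by two paths with the same ends: [lo]
    along the lower half-circle and [hi] along the upper one, both from left
    to right. For [c = 0] it is constant along rays. *)
Definition bigon {E T : Type} (eps : E -> R -> T) (p : T) (lo hi : seq E) (c : R) (z : R * R) : T :=
  let s := (dirx c z + 1) / 2 in
  if z.2 <= 0 then walk eps p lo ((size lo)%:R * s) else walk eps p hi ((size hi)%:R * s).

Lemma bigon_map (E T U : Type) (g : T -> U) (eps : E -> R -> T) p lo hi c z :
  g (bigon eps p lo hi c z) = bigon (fun e s => g (eps e s)) (g p) lo hi c z.
Proof. by rewrite /bigon; case: (z.2 <= 0); exact: walk_map. Qed.

Lemma bigonZ (E T : Type) (eps : E -> R -> T) p lo hi (a : R) z : 0 < a ->
  bigon eps p lo hi 0 (a *: z) = bigon eps p lo hi 0 z.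
Proof. by move=> a0; rewrite /bigon dirxZ //= pmulr_rle0. Qed.

(** At the two corners of the bigon, both paths are at a common end. *)
Lemma bigon_axis (E T : Type) (eps : E -> R -> T) p lo hi c z :
  linked eps p lo -> linked eps p hi -> walk_end eps p lo = walk_end eps p hi ->
  0 < c -> c <= rad z -> z.2 = 0 ->
  let s := (dirx c z + 1) / 2 in
  walk eps p lo ((size lo)%:R * s) = walk eps p hi ((size hi)%:R * s).
Proof.
move=> l1 l2 ends c0 cz z2; case: (dirx_axis c0 cz z2) => -> /=.
  by rewrite (_ : (1 + 1) / 2 = 1) ?mulr1 ?walk_size //; lra.
by rewrite addNr mul0r !mulr0 !walk0.
Qed.

End Polar.

(** * Two-dimensional complexes with bigonal faces *)

Fixpoint chain (V : eqType) (E : Type) (src tgt : E -> V) (p : V) (es : seq E) : bool :=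
  if es is e :: es' then (src e == p) && chain src tgt (tgt e) es' else true.

(** A combinatorial 2-complex whose faces are bigons, so that the boundary of
    a face is a relation [lo = hi] between two edge paths. *)
Record cell_data := CellData {
  vert : finType; edge : finType; face : finType;
  src : edge -> vert; tgt : edge -> vert; base : face -> vert;
  lo : face -> seq edge; hi : face -> seq edge;
  lo_chain : forall f, chain src tgt (base f) (lo f);
  hi_chain : forall f, chain src tgt (base f) (hi f);
  same_end : forall f, last (base f) (map tgt (lo f)) = last (base f) (map tgt (hi f))
}.
Arguments src {c} _. Arguments tgt {c} _. Arguments base {c} _.
Arguments lo {c} _. Arguments hi {c} _.

Definition open_unit (R : realType) := {s : R | (0 < s) && (s < 1)}.
Definition open_unit_disc (R : realType) := {z : R * R | rad z < 1}.

(** The underlying set of the complex: its open cells, side by side. *)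
Definition realization (K : cell_data) (R : realType) := (vert K + (edge K * open_unit R) + (face K * open_unit_disc R))%type.
HB.instance Definition _ K R := Choice.on (realization K R).

Section Points.
Variables (K : cell_data) (R : realType).
Local Notation T := (realization K R).

Definition Vx (v : vert K) : T := inl (inl v).
Definition Ed (e : edge K) (i : open_unit R) : T := inl (inr (e, i)).
Definition Fc (f : face K) (d : open_unit_disc R) : T := inr (f, d).

(** The path along an edge, constant outside of the unit interval so that it
    is defined on the whole line. *)
Definition edgept (e : edge K) (s : R) : T :=
  if insub s is Some i then Ed e i else Vx (if s <= 0 then src e else tgt e).

Definition att (f : face K) (z : R * R) : T :=
  bigon edgept (Vx (base f)) (lo f) (hi f) 0 z.

(** The characteristic map of a face, extended to the plane to be constant
    along rays outside of the disc. *)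
Definition facept (f : face K) (z : R * R) : T :=
  if insub z is Some d then Fc f d else att f z.

(** The final topology for the extended characteristic maps. *)
Definition cellwise_open (A : set T) :=
  (forall e, open (edgept e @^-1` A)) /\ (forall f, open (facept f @^-1` A)).

Lemma cellwise_openT : cellwise_open setT.
Proof. by split=> *; rewrite preimage_setT; exact: openT. Qed.

Lemma cellwise_openI : setI_closed cellwise_open.
Proof. by move=> A B [A1 A2] [B1 B2]; split=> i; rewrite preimage_setI; apply: openI. Qed.

Lemma cellwise_open_bigcup (I : Type) (g : I -> set T) : (forall i, cellwise_open (g i)) -> cellwise_open (\bigcup_i g i).
Proof.
by move=> og; split=> i; rewrite preimage_bigcup; apply: bigcup_open => j _; have [] := og j.
Qed.

HB.instance Definition _ := isOpenTopological.Build T cellwise_openT cellwise_openI cellwise_open_bigcup.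

Lemma edgept_cont e : continuous (edgept e).
Proof. by apply/continuousP => A [oA _]; exact: oA. Qed.

Lemma facept_cont f : continuous (facept f).
Proof. by apply/continuousP => A [_ oA]; exact: oA. Qed.

Lemma cont_from_cells (U : topologicalType) (h : T -> U) :
  (forall e, continuous (fun s => h (edgept e s))) ->
  (forall f, continuous (fun z => h (facept f z))) -> continuous h.
Proof.
move=> he hf; apply/continuousP => A oA.
by split=> [e|f]; [have /continuousP := he e|have /continuousP := hf f]; apply.
Qed.

Lemma edgept_le0 e s : s <= 0 -> edgept e s = Vx (src e).
Proof. by move=> s0; rewrite /edgept insubF ?s0 // ltNge s0. Qed.

Lemma edgept_ge1 e s : 1 <= s -> edgept e s = Vx (tgt e).
Proof.
move=> s1; rewrite /edgept insubF; last by rewrite (ltNge s) s1 andbF.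
by rewrite leNgt (lt_le_trans ltr01 s1).
Qed.

Lemma edgept_in e (i : open_unit R) : edgept e (val i) = Ed e i.
Proof. by rewrite /edgept valK. Qed.

Lemma edgeptP e s : [\/ s <= 0 /\ edgept e s = Vx (src e), 1 <= s /\ edgept e s = Vx (tgt e)
  | exists2 i : open_unit R, s = val i & edgept e s = Ed e i].
Proof.
have [s0|s0] := lerP s 0; first by constructor 1; rewrite edgept_le0.
have [s1|s1] := lerP 1 s; first by constructor 2; rewrite edgept_ge1.
have s01 : (0 < s) && (s < 1) by rewrite s0.
by constructor 3; exists (Sub s s01) => //; rewrite -edgept_in.
Qed.

Lemma facept_in f (d : open_unit_disc R) : facept f (val d) = Fc f d.
Proof. by rewrite /facept valK. Qed.

Lemma facept_ge1 f z : 1 <= rad z -> facept f z = att f z.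
Proof. by move=> z1; rewrite /facept insubF // ltNge z1. Qed.

Lemma faceptP f z : (1 <= rad z /\ facept f z = att f z) \/
  exists2 d : open_unit_disc R, z = val d & facept f z = Fc f d.
Proof.
have [z1|z1] := lerP 1 (rad z); first by left; rewrite facept_ge1.
by right; exists (Sub z z1) => //; rewrite -facept_in.
Qed.

Lemma edgept0 e : edgept e 0 = Vx (src e). Proof. by rewrite edgept_le0. Qed.
Lemma edgept1 e : edgept e 1 = Vx (tgt e). Proof. by rewrite edgept_ge1. Qed.

Lemma chain_linked p es : chain src tgt p es -> linked edgept (Vx p) es.
Proof. by elim: es p => //= e es IH p /andP[/eqP <- /IH]; rewrite edgept0 edgept1. Qed.

Lemma chain_end p es : walk_end edgept (Vx p) es = Vx (last p (map tgt es)).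
Proof. by rewrite /walk_end; elim: es p => //= e es IH p; rewrite edgept1 IH. Qed.

Lemma lo_linked f : linked edgept (Vx (base f)) (lo f).
Proof. exact/chain_linked/lo_chain. Qed.

Lemma hi_linked f : linked edgept (Vx (base f)) (hi f).
Proof. exact/chain_linked/hi_chain. Qed.

Lemma lohi_end f : walk_end edgept (Vx (base f)) (lo f) = walk_end edgept (Vx (base f)) (hi f).
Proof. by rewrite !chain_end same_end. Qed.

Definition in_graph (p : T) := if p is inl _ then true else false.

Lemma edgept_graph e s : in_graph (edgept e s).
Proof. by rewrite /edgept; case: insub. Qed.

Lemma walk_graph p es u : in_graph p -> in_graph (walk edgept p es u).
Proof.
by elim: es p u => //= e es IH p u gp; case: ifP => _; [|apply: IH]; exact: edgept_graph.
Qed.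

Lemma att_graph f z : in_graph (att f z).
Proof. by rewrite /att /bigon; case: ifP => _; exact: walk_graph. Qed.

Lemma ptP (p : T) : [\/ exists v, p = Vx v, exists e, exists i, p = Ed e i | exists f, exists d, p = Fc f d].
Proof.
case: p => [[v|[e i]]|[f d]]; [constructor 1|constructor 2|constructor 3]; first by exists v.
  by exists e, i.
by exists f, d.
Qed.

(** Extension of a function on the graph to the faces, by a collar in which it
    fades out; it vanishes near the centres. *)
Definition extend_graph (k : T -> R) (p : T) : R :=
  if p is inr (f, d) then Num.max 0 (2 * rad (val d) - 1) * k (att f (val d)) else k p.

Lemma extend_graph_cont (k : T -> R) : (forall e, continuous (fun s => k (edgept e s))) ->
  continuous (extend_graph k).
Proof.
move=> ck; apply: cont_from_cells => [e|f].
  by rewrite (_ : (fun s => _) = (fun s => k (edgept e s))) //; apply/funext => s; rewrite /edgept; case: insub.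
pose w := fun z : R * R => Num.min 1 (Num.max 0 (2 * rad z - 1)).
pose eps := fun (z : R * R) e s => k (edgept e s).
pose br (es : seq (edge K)) z := walk (eps z) (k (Vx (base f))) es ((size es)%:R * ((dirx 2^-1 z + 1) / 2)).
have cr : continuous (@rad R) by exact: (@rad_cont R _ id (@cont_id _)).
have cw : continuous w by rewrite /w; cont.
have cd : continuous (fun z : R * R => dirx 2^-1 z).
  by apply: (dirx_cont _ (@cont_id _)); rewrite invr_gt0 ltr0n.
have cbr es : linked edgept (Vx (base f)) es -> continuous (br es).
  move=> l; apply: walk_cont; [|by cont|by cont|by move=> s; exact: linked_map].
  by move=> e; exact: cont_comp (@cont_snd _ _) (ck e).
have val_at z : 0 <= rad z - 2^-1 -> extend_graph k (facept f z) = w z * k (att f z).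
  move=> z2; rewrite /w; case: (faceptP f z) => [[z1 ->]|[d dE ->]] /=.
    rewrite max_r; last lra.
    rewrite min_l; last lra.
    by rewrite mul1r; have := att_graph f z; case: (att f z).
  have := valP d => /= d1; rewrite -dE in d1 *; rewrite (min_r) //.
  by rewrite ge_max ler01 /=; lra.
have brE z es : 0 <= rad z - 2^-1 ->
    k (walk edgept (Vx (base f)) es ((size es)%:R * ((dirx 0 z + 1) / 2))) = br es z.
  by move=> z2; rewrite walk_map /br dirx_ge //; lra.
apply: (@cont_glue _ _ _ (fun z => rad z - 2^-1) (fun z => z.2) _
  (fun z => w z * 0) (fun z => w z * br (lo f) z) (fun z => w z * br (hi f) z)).
- by cont.
- by cont.
- by cont.
- by apply: contM cw _; apply: cbr; exact: lo_linked.
- by apply: contM cw _; apply: cbr; exact: hi_linked.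
- move=> z z2; rewrite mulr0; case: (faceptP f z) => [[z1 _]|[d dE ->]] /=.
    by exfalso; lra.
  by rewrite -dE max_l ?mul0r //; lra.
- by move=> z z2 lz; rewrite val_at // /att /bigon lz /= brE.
- move=> z z2 hz; rewrite val_at // /att /bigon.
  case: (ltgtP z.2 0) hz => //= [_ _|z0 _]; first by rewrite brE.
  rewrite -brE //; congr (_ * k _); rewrite -(@dirx_ge _ 2^-1); last lra.
  apply: bigon_axis => //; [exact: lo_linked|exact: hi_linked|exact: lohi_end|lra].
Qed.

Definition fbump (f : face K) (g : R * R -> R) (p : T) : R :=
  if p is inr (f', d) then if f' == f then (1 - rad (val d)) * g (val d) else 0 else 0.

Lemma fbump_cont f g : continuous g -> continuous (fbump f g).
Proof.
move=> cg; apply: cont_from_cells => [e|f'].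
  by rewrite (_ : (fun s => _) = (fun s => 0)); [cont|apply/funext => s; rewrite /edgept; case: insub].
have cr : continuous (@rad R) by exact: (@rad_cont R _ id (@cont_id _)).
rewrite (_ : (fun z => _) = (fun z => if f' == f then Num.max 0 (1 - rad z) * g z else 0)).
  by case: (_ == _) => /=; cont.
apply/funext => z; case: (faceptP f' z) => [[z1 ->]|[d -> ->]] /=.
  rewrite max_l ?mul0r; last lra.
  have := att_graph f' z; case: (att f' z) => // p _; by case: ifP.
by rewrite max_r // subr_ge0; have /ltW := valP d.
Qed.

Definition ebump (e : edge K) (g : R -> R) (p : T) : R :=
  if p is inl (inr (e', i)) then if e' == e then val i * (1 - val i) * g (val i) else 0 else 0.

Lemma ebump_cont e g : continuous g -> continuous (extend_graph (ebump e g)).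
Proof.
move=> cg; apply: extend_graph_cont => e'.
rewrite (_ : (fun z => _) = (fun s => if e' == e then Num.max 0 s * Num.max 0 (1 - s) * g s else 0)).
  by case: (_ == _) => /=; cont.
apply/funext => s; case: (edgeptP e' s) => [[s0 ->]|[s1 ->]|[i -> ->]] /=.
- by rewrite max_l // !mul0r; case: ifP.
- by rewrite (@max_l _ _ _ (1 - s)) ?mulr0 ?mul0r; [case: ifP|lra].
by have /andP[i0 i1] := valP i; case: ifP => // _; rewrite !max_r // ?subr_ge0 ltW.
Qed.

Definition vbump (v : vert K) (p : T) : R :=
  match p with
  | inl (inl v') => (v' == v)%:R
  | inl (inr (e, i)) => (1 - val i) * (src e == v)%:R + val i * (tgt e == v)%:R
  | _ => 0
  end.

Lemma vbump_cont v : continuous (extend_graph (vbump v)).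
Proof.
apply: extend_graph_cont => e.
rewrite (_ : (fun z => _) = (fun s => Num.max 0 (Num.min 1 (1 - s)) * (src e == v)%:R + Num.max 0 (Num.min 1 s) * (tgt e == v)%:R)).
  by cont.
apply/funext => s; case: (edgeptP e s) => [[s0 ->]|[s1 ->]|[i -> ->]] /=.
- rewrite (@min_l _ _ 1); last lra.
  rewrite min_r; last lra.
  by rewrite max_r ?ler01 // max_l // mul0r addr0 mul1r.
- rewrite (@min_r _ _ _ (1 - s)); last lra.
  rewrite min_l; last lra.
  by rewrite max_l; [rewrite max_r ?ler01 // mul0r add0r mul1r|lra].
case: i => r /= /andP[r0 r1].
rewrite (@min_r _ _ _ (1 - r)); last lra.
rewrite (@min_r _ _ _ r); last lra.
by rewrite !max_r //; lra.
Qed.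

(** Bump functions on the faces, on the edges (extended to the faces), and
    tent functions around the vertices suffice. *)
Lemma points_separated (p q : T) : (forall h : T -> R, continuous h -> h p = h q) -> p = q.
Proof.
move=> sep.
have sepF f d : (forall h : T -> R, continuous h -> h (Fc f d) = h q) -> Fc f d = q.
  move=> sp; have d1 : 1 - rad (val d) != 0 by rewrite subr_eq0 gt_eqF //; have := valP d.
  have h0 := sp _ (@fbump_cont f _ (@cont_cst _ R (1 : R))).
  have h1 := sp _ (@fbump_cont f _ (@cont_fst _ _)).
  have h2 := sp _ (@fbump_cont f _ (@cont_snd _ _)).
  move: h0 h1 h2; rewrite /fbump /= eqxx mulr1; case: q {sep sp} => [a /eqP|[f' d']]; first by rewrite (negPf d1).
  case: eqP => [-> /=|_ /eqP]; last by rewrite (negPf d1).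
  rewrite mulr1 => dE; rewrite -dE => /(mulfI d1) h1 /(mulfI d1) h2.
  congr (inr (_, _)); apply: val_inj.
  move: h1 h2 => /=; case: (sval d) (sval d') => [x y] [x' y'] /=.
  by move=> -> ->.
have sepE e i : (forall h : T -> R, continuous h -> h (Ed e i) = h q) -> in_graph q -> Ed e i = q.
  move=> sp; have /andP[i0 i1] := valP i.
  have i01 : sval i * (1 - sval i) != 0 by rewrite mulf_neq0 ?subr_eq0 ?gt_eqF.
  have h0 := sp _ (@ebump_cont e _ (@cont_cst _ R (1 : R))).
  have h1 := sp _ (@ebump_cont e _ (@cont_id _)).
  move: h0 h1; rewrite /ebump /= eqxx mulr1; case: q {sep sp sepF} => [|//] [a /eqP|[e' i']]; first by rewrite (negPf i01).
  rewrite /=; case: (e' =P e) => [-> /=|_ /eqP]; last by rewrite (negPf i01).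
  rewrite mulr1 => iE; rewrite -iE => /(mulfI i01) h1 _.
  by congr (inl (inr (_, _))); exact: val_inj.
case: (ptP p) => [[v pE]|[e [i pE]]|[f [d pE]]]; last by rewrite pE; apply: sepF; rewrite -pE.
  have h0 := sep _ (@vbump_cont v).
  case: (ptP q) => [[v' qE]|[e [i qE]]|[f [d qE]]].
  - move: h0; rewrite pE qE /= eqxx; case: eqP => [->//|_ /eqP]; by rewrite oner_eq0.
  - have := sep _ (@ebump_cont e _ (@cont_cst _ R (1 : R))); rewrite pE qE /= eqxx mulr1 => /esym /eqP.
    by have /andP[i0 i1] := valP i; rewrite mulf_eq0 subr_eq0 !gt_eqF.
  - have := sep _ (@fbump_cont f _ (@cont_cst _ R (1 : R))); rewrite pE qE /= eqxx mulr1 => /esym /eqP.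
    by have d1 := valP d; rewrite subr_eq0 gt_eqF.
case: (ptP q) => [[v qE]|[e' [i' qE]]|[f [d qE]]].
- by rewrite pE; apply: sepE; [rewrite -pE|rewrite qE].
- by rewrite pE; apply: sepE; [rewrite -pE|rewrite qE].
have := sep _ (@fbump_cont f _ (@cont_cst _ R (1 : R))); rewrite pE qE /= eqxx mulr1 => /esym /eqP.
by have d1 := valP d; rewrite subr_eq0 gt_eqF.
Qed.

Lemma realization_hausdorff : hausdorff_space T.
Proof.
move=> p q pq; apply: points_separated => h ch.
apply: (@norm_hausdorff R R) => A B Ap Bq.
have [x [Ax Bx]] := pq _ _ (ch p A Ap) (ch q B Bq).
by exists (h x).
Qed.

End Points.

(** * The CW structure *)

Section Rows.
Context {R : realType}.

Definition row1 (s : R) : 'rV[R]_1 := \row__ s.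
Definition row2 (z : R * R) : 'rV[R]_2 := \row_i (if i == ord0 then z.1 else z.2).
Definition unrow2 (x : 'rV[R]_2) : R * R := (x ord0 ord0, x ord0 ord_max).

Lemma mx_cont (S : topologicalType) n (f : S -> 'rV[R]_n) :
  (forall j, continuous (fun s => f s ord0 j)) -> continuous f.
Proof.
move=> cf s A [P fP PA]; rewrite nbhs_simpl /=.
apply: (@filterS _ _ _ [set t | forall j, P ord0 j (f t ord0 j)]).
  by move=> t Pt; apply: PA => i j; rewrite !ord1.
by apply: filter_forall => j; apply: cf; exact: fP.
Qed.

Lemma row1_cont : continuous row1.
Proof.
apply: mx_cont => j; rewrite (_ : (fun s => _) = (fun s => s)); first exact: cont_id.
by apply/funext => s; rewrite mxE.
Qed.

Lemma row2_cont : continuous row2.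
Proof.
apply: mx_cont => j; rewrite (_ : (fun s => _) = (if j == ord0 then fst else snd)).
  by case: eqP => _; [exact: cont_fst|exact: cont_snd].
by apply/funext => s; rewrite mxE; case: eqP.
Qed.

Lemma unrow2_cont : continuous unrow2.
Proof. by apply: cont_pair => x; exact: coord_continuous. Qed.

Lemma unrow2K : cancel unrow2 row2.
Proof.
move=> x; apply/rowP => i; rewrite mxE /=; case: eqP => [->//|i0].
by congr (x _ _); apply/val_inj; case: i i0 => [[|[|]]] //= ? /eqP.
Qed.

Lemma row2K : cancel row2 unrow2.
Proof. by case=> x y; rewrite /unrow2 !mxE. Qed.

Lemma sqnorm1 (x : 'rV[R]_1) : sqnorm x = x ord0 ord0 ^+ 2.
Proof. by rewrite /sqnorm big_ord1. Qed.

Lemma sqnorm2 (x : 'rV[R]_2) : sqnorm x = rad (unrow2 x) ^+ 2.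
Proof. by rewrite sqr_rad /sqnorm big_ord_recl big_ord1 /=; congr (_ + x _ _ ^+ 2); apply/val_inj. Qed.

Lemma sqnorm_cont n : continuous (@sqnorm R n).
Proof.
apply: (@cont_sum R _ _ _ (fun i (x : 'rV[R]_n) => x ord0 i ^+ 2)) => i.
by apply: (@contX R _ (fun x : 'rV[R]_n => x ord0 i) 2) => x; exact: coord_continuous.
Qed.

Lemma disc_compact n : compact (disc R n).
Proof.
apply: bounded_closed_compact; last by apply: closed_sublevel; exact: sqnorm_cont.
exists 1; split; first exact: real1.
move=> M M1 x /= x1; rewrite [leLHS]/Num.norm /= mx_normrE.
apply/bigmax_leP; split=> [|[i j] _ /=]; first by rewrite ltW // (lt_trans ltr01).
apply: le_trans (ltW M1); rewrite -(@ler_pXn2r _ 2) ?nnegrE // expr1n real_normK ?num_real //.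
apply: le_trans x1; rewrite /sqnorm (bigD1 j) //= (ord1 i) lerDl.
by apply: sumr_ge0 => k _; exact: sqr_ge0.
Qed.

Lemma disc_split n (x : 'rV[R]_n) : disc R n x -> open_disc R n x \/ sphere R n x.
Proof. by rewrite /disc /open_disc /sphere /= le_eqVlt => /orP[/eqP|]; [right|left]. Qed.

End Rows.

(** Openness of the map onto its image uses compactness of the closed disc:
    the image of the complement of an open set is closed. *)
Lemma cell_homeo (R : realType) (T : topologicalType) n (c : 'rV[R]_n -> T) :
  hausdorff_space T -> continuous c -> set_inj (open_disc R n) c ->
  (forall x y, sphere R n x -> open_disc R n y -> c x <> c y) ->
  homeo_on (open_disc R n) (c @` open_disc R n) c.
Proof.
move=> hT cc ci cb; split; first exact: continuous_subspaceT.
split; first by split=> // x xo; exists x.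
move=> V oV; pose D := c @` (disc R n `&` ~` V).
have cD : closed D.
  apply: compact_closed => //; apply: continuous_compact; first exact: continuous_subspaceT.
  by apply: compact_closedI; [exact: disc_compact|exact: open_closedC].
exists (~` D); first exact: closed_openC.
apply/seteqP; split=> p /=.
  move=> [x [xo Vx] <-]; split; first by exists x.
  move=> [y [yd nVy] yx]; case: (disc_split yd) => [yo|ys].
    by apply: nVy; rewrite (ci y x) ?inE.
  exact: cb ys xo yx.
move=> [[x xo <-] nD]; exists x => //; split=> //; apply: contrapT => nV; apply: nD.
by exists x => //; split=> //; exact: ltW.
Qed.

Section CW.
Variables (K : cell_data) (R : realType).
Local Notation T := (realization K R).

Definition cells (n : nat) : choiceType :=
  match n with 0 => vert K | 1 => edge K | 2 => face K | _ => void end.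

Definition cell_char (n : nat) : cells n -> 'rV[R]_n -> T :=
  match n with
  | 0 => fun v _ => Vx R v
  | 1 => fun e x => edgept e ((x ord0 ord0 + 1) / 2)
  | 2 => fun f x => facept f (unrow2 x)
  | _ => fun v _ => match v with end
  end.
Arguments cell_char : clear implicits.

Lemma cell_char_cont n (c : cells n) : continuous (cell_char n c).
Proof.
case: n c => [|[|[|//]]] c /=.
- exact: cont_cst.
- apply: (@cont_comp _ _ _ (fun x : 'rV[R]_1 => (x ord0 ord0 + 1) / 2)); last exact: edgept_cont.
  have c0 : continuous (fun x : 'rV[R]_1 => x ord0 ord0) by move=> x; exact: coord_continuous.
  by cont.
- exact: cont_comp unrow2_cont (facept_cont (f:=c)).
Qed.

Definition celldim (p : T) : nat :=
  match p with inl (inl _) => 0 | inl (inr _) => 1 | _ => 2 end.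

Definition cellof (p : T) : {n : nat & cells n} :=
  match p with
  | inl (inl v) => existT cells 0 v
  | inl (inr (e, _)) => existT cells 1 e
  | inr (f, _) => existT cells 2 f
  end.

Lemma open_disc1 (x : 'rV[R]_1) : open_disc R 1 x = ((0 < (x ord0 ord0 + 1) / 2) && ((x ord0 ord0 + 1) / 2 < 1)) :> Prop.
Proof.
rewrite /open_disc /= sqnorm1 expr2; apply/propext; split=> [h|/andP[h1 h2]].
  by apply/andP; split; nra.
nra.
Qed.

Lemma cell_char_open n (c : cells n) x : open_disc R n x -> cellof (cell_char n c x) = existT _ n c.
Proof.
case: n c x => [|[|[|//]]] c x //=.
- rewrite open_disc1 => /andP[x0 x1]; case: (edgeptP c ((x ord0 ord0 + 1) / 2)) => [[]|[]|[i _ ->]] //.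
    by rewrite leNgt x0.
  by rewrite leNgt x1.
- rewrite /open_disc /= sqnorm2; case: (faceptP c (unrow2 x)) => [[r1 _]|[d _ ->]//].
  by rewrite ltNge expr_ge1 ?rad_ge0 ?r1.
Qed.

Lemma cell_char_inj n (c : cells n) : set_inj (open_disc R n) (cell_char n c).
Proof.
case: n c => [|[|[|//]]] c x y; rewrite !inE /=.
- by move=> _ _ _; apply/rowP => -[].
- rewrite !open_disc1 => /andP[x0 x1] /andP[y0 y1].
  case: (edgeptP c ((x ord0 ord0 + 1) / 2)) => [[? _]|[? _]|[i xi ->]]; [by exfalso; lra|by exfalso; lra|].
  case: (edgeptP c ((y ord0 ord0 + 1) / 2)) => [[? _]|[? _]|[j yj ->]]; [by exfalso; lra|by exfalso; lra|].
  move=> [ij]; apply/rowP => k; rewrite (ord1 k).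
  have : (x ord0 ord0 + 1) / 2 = (y ord0 ord0 + 1) / 2 by rewrite xi yj ij.
  lra.
- rewrite /open_disc /= !sqnorm2 => x1 y1.
  case: (faceptP c (unrow2 x)) => [[r1 _]|[d dE ->]].
    by move: x1; rewrite ltNge expr_ge1 ?rad_ge0 ?r1.
  case: (faceptP c (unrow2 y)) => [[r1 _]|[d' dE' ->]].
    by move: y1; rewrite ltNge expr_ge1 ?rad_ge0 ?r1.
  by move=> [dd]; apply: (can_inj unrow2K); rewrite dE dE' dd.
Qed.

Lemma cell_char_sphere n (c : cells n) x : sphere R n x -> (celldim (cell_char n c x) < n)%N.
Proof.
case: n c x => [|[|[|//]]] c x; rewrite /sphere /=.
- by rewrite /sqnorm big_ord0 => /eqP; rewrite eq_sym oner_eq0.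
- rewrite sqnorm1 => /eqP; rewrite sqrf_eq1 => /orP[] /eqP ->.
    by rewrite edgept_ge1 //; lra.
  by rewrite edgept_le0 //; lra.
- rewrite sqnorm2 => /eqP; rewrite sqrf_eq1 => /orP[] /eqP r1; last first.
    by have := rad_ge0 (unrow2 x); rewrite r1 oppr_ge0 ler10.
  by rewrite facept_ge1 ?r1 //; have := att_graph c (unrow2 x); case: (att c (unrow2 x)) => [[]|].
Qed.

Lemma celldimE p : celldim p = projT1 (cellof p).
Proof. by case: p => [[|[]]|[]]. Qed.

Lemma cellof_pt (p : T) : exists2 x, open_disc R (projT1 (cellof p)) x & cell_char _ (projT2 (cellof p)) x = p.
Proof.
case: (ptP p) => [[v ->]|[e [i ->]]|[f [d ->]]] /=.
- by exists 0 => //; rewrite /open_disc /= /sqnorm big_ord0.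
- have := valP i => i01; exists (row1 (2 * val i - 1)).
    by rewrite open_disc1 mxE; move/andP: i01 => [i0 i1]; apply/andP; split; lra.
  by rewrite mxE -edgept_in; congr edgept; lra.
- exists (row2 (val d)); last by rewrite row2K facept_in.
  by rewrite /open_disc /= sqnorm2 row2K expr_lt1 ?rad_ge0 //; exact: (valP d).
Qed.

Lemma cell_char_boundary n (c : cells n) x y : sphere R n x -> open_disc R n y -> cell_char n c x <> cell_char n c y.
Proof.
move=> /(cell_char_sphere c) + /(@cell_char_open _ c) yo xy.
by rewrite xy celldimE yo /= ltnn.
Qed.

Lemma edgept_clamp (e : edge K) (s : R) : edgept e s = edgept e (Num.max 0 (Num.min 1 s)).
Proof.
case: (ltP s 0) => [s0|s0].
  by rewrite !edgept_le0 ?ge_max ?lexx ?ge_min ?(ltW s0) ?orbT.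
case: (ltP 1 s) => [s1|s1].
  by rewrite !edgept_ge1 ?le_max ?le_min ?lexx ?(ltW s1) ?orbT.
by rewrite max_r.
Qed.

(** Radial retraction of the plane onto the unit disc. *)
Definition to_disc (z : R * R) : R * R := (Num.max 1 (rad z))^-1 *: z.

Lemma to_disc_in z : rad z <= 1 -> to_disc z = z.
Proof. by move=> r; rewrite /to_disc max_l // invr1 scale1r. Qed.

Lemma rad_to_disc z : rad (to_disc z) = Num.min 1 (rad z).
Proof.
rewrite /to_disc radZ; last by rewrite invr_ge0 le_max ler01.
case: (lerP (rad z) 1) => r; first by rewrite invr1 mul1r.
by rewrite mulVf // gt_eqF // (lt_trans ltr01).
Qed.

Lemma to_disc_cont : continuous to_disc.
Proof.
have cr : continuous (@rad R) by exact: (@rad_cont R _ id (@cont_id _)).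
rewrite /to_disc; apply: cont_pair; apply: contM; cont; apply: contV; cont;
  by move=> x; rewrite gt_eqF // lt_max ltr01.
Qed.

Lemma facept_to_disc (f : face K) (z : R * R) : facept f z = facept f (to_disc z).
Proof.
case: (ltP (rad z) 1) => [r|r]; first by rewrite to_disc_in // ltW.
rewrite !facept_ge1 ?rad_to_disc ?min_l // /att /to_disc bigonZ // invr_gt0.
by rewrite lt_max ltr01.
Qed.

(** The extended characteristic maps factor through the retraction of the line
    or plane onto the closed cell, so a set that is closed in the closed cells
    is closed for the final topology. *)
Lemma weak_topology (A : set T) : (forall n (c : cells n), closed (disc R n `&` cell_char n c @^-1` A)) -> closed A.
Proof.
move=> cA; rewrite -[A]setCK; apply: open_closedC; split=> [e|f]; rewrite preimage_setC; apply: closed_openC.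
  have HE : edgept e @^-1` A = (fun s => row1 (2 * Num.max 0 (Num.min 1 s) - 1)) @^-1` (disc R 1 `&` cell_char 1 e @^-1` A).
    apply/funext => s; rewrite /preimage /= mxE.
    rewrite (_ : (2 * _ - 1 + 1) / 2 = Num.max 0 (Num.min 1 s)); last lra.
    rewrite -edgept_clamp; apply/propext; split=> [As|[]//]; split=> //.
    rewrite /disc /= sqnorm1 mxE; set m := Num.max _ _.
    have m0 : 0 <= m by rewrite le_max lexx.
    have m1 : m <= 1 by rewrite ge_max ler01 ge_min lexx.
    by rewrite expr2; nra.
  rewrite -[X in closed X]/(edgept e @^-1` A) HE; suff c1 : continuous (fun s : R => row1 (2 * Num.max 0 (Num.min 1 s) - 1)).
    by apply: preimage_closed (cA 1%N e) => s _; exact: c1.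
  apply: (@cont_comp _ _ _ (fun s : R => 2 * Num.max 0 (Num.min 1 s) - 1)); last exact: row1_cont.
  by cont.
have HE : facept f @^-1` A = (fun z => row2 (to_disc z)) @^-1` (disc R 2 `&` cell_char 2 f @^-1` A).
  apply/funext => z; rewrite /preimage /= row2K -facept_to_disc.
  apply/propext; split=> [As|[]//]; split=> //.
  rewrite /disc /= sqnorm2 row2K rad_to_disc expr_le1 ?ge_min ?lexx // le_min ler01.
  exact: rad_ge0.
rewrite -[X in closed X]/(facept f @^-1` A) HE; apply: preimage_closed (cA 2%N f) => s _.
exact: (cont_comp to_disc_cont row2_cont).
Qed.

Lemma finite_cells (P : set {n : nat & cells n}) : finite_set P.
Proof.
apply: (@sub_finite_set _ _ ((existT cells 0%N) @` [set: vert K] `|` (existT cells 1%N) @` [set: edge K] `|` (existT cells 2%N) @` [set: face K])).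
  by move=> [[|[|[|//]]] c] _; [left; left|left; right|right]; exists c.
by rewrite !finite_setU; split; [split|]; apply: finite_image; exact: finite_finset.
Qed.

Definition cw_of : cwComplex R.
refine (@CWComplex R T cells cell_char (@realization_hausdorff K R) _ _ _ _ _ weak_topology).
- by move=> n c; apply: continuous_subspaceT; exact: cell_char_cont.
- move=> n c; apply: cell_homeo; [exact: realization_hausdorff|exact: cell_char_cont|exact: cell_char_inj|].
  by move=> x y; exact: cell_char_boundary.
- move=> [n c] [m d] _ _ [p [[x xo <-] [y yo]]] /= xy.
  by rewrite -(cell_char_open c xo) -(cell_char_open d yo) xy.
- rewrite predeqE => p; split=> // _; exists (cellof p) => //=.
  by have [x xo xp] := cellof_pt p; exists x.
- move=> n c; exists [set d | (projT1 d < n)%N]; split=> //; first exact: finite_cells.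
  move=> p [x xs <-]; exists (cellof (cell_char n c x)).
    by rewrite /= -celldimE; exact: cell_char_sphere.
  by have [y yo yp] := cellof_pt (cell_char n c x); exists y.
Defined.

Definition complex_of : complex2 R.
refine (@Complex2 R cw_of _).
by move=> [|[|[|n]]].
Defined.

Lemma card_cells (U : finType) : #|` fset_set [set: U]| = #|U|.
Proof.
rewrite -(card_finset U); congr (#|` _|); apply/fsetP => x.
by rewrite in_fset_set ?inE; [exact/mem_set|exact: finite_finset].
Qed.

End CW.

(** * Euler characteristic, compactness, connectedness *)

Lemma euler_complex_of (K : cell_data) (R : realType) :
  euler_char (complex_of K R) = (#|vert K|%:Z - #|edge K|%:Z + #|face K|%:Z).
Proof.
rewrite /euler_char !big_ord_recl big_ord0 /= !card_cells.
by rewrite expr0 expr1 mul1r mulN1r sqrrN expr1n mul1r addr0 addrA.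
Qed.

Lemma hausdorff_pair (S T : topologicalType) :
  hausdorff_space S -> hausdorff_space T -> hausdorff_space (S * T)%type.
Proof.
move=> hS hT [p p'] [q q'] cl; congr (_, _).
  apply: hS => A B Ap Bq.
  have [||x [Ax Bx]] := cl (A `*` setT) (B `*` setT); last by exists x.1; case: Ax Bx => ? _ [].
    by exists (A, setT) => //=; split=> //; exact: filterT.
  by exists (B, setT) => //=; split=> //; exact: filterT.
apply: hT => A B Ap Bq.
have [||x [Ax Bx]] := cl (setT `*` A) (setT `*` B); last by exists x.2; case: Ax Bx => _ ? [].
  by exists (setT, A) => //=; split=> //; exact: filterT.
by exists (setT, B) => //=; split=> //; exact: filterT.
Qed.

Lemma tube_open (R : realType) (S U : topologicalType) (h : S * R -> U) (A : set U) (J : set R) :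
  continuous h -> open A -> compact J -> open [set x | forall t, J t -> A (h (x, t))].
Proof.
move=> ch oA /compact_near_coveringP cJ; rewrite openE => x xJ.
have := cJ S (nbhs x) (fun y t => A (h (y, t))) _; apply => t Jt.
have : nbhs (x, t) (h @^-1` A) by apply: ch; apply: open_nbhs_nbhs; split=> //; exact: xJ.
move=> [[P Q] [/= Px Qt] PQ]; exists (Q, P) => //= -[t' x'] [/= Qt' Px'].
exact: (PQ (x', t')).
Qed.

Section Topology.
Variables (K : cell_data) (R : realType).
Local Notation T := (realization K R).

(** The product of the final topology with the line is again final, by the
    tube lemma: this is what allows homotopies to be built cell by cell. *)
Lemma cont_from_cells_cyl (U : topologicalType) (h : T * R -> U) :
  (forall v, continuous (fun t => h (Vx R v, t))) ->
  (forall e, continuous (fun st : R * R => h (edgept e st.1, st.2))) ->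
  (forall f, continuous (fun zt : (R * R) * R => h (facept f zt.1, zt.2))) -> continuous h.
Proof.
move=> hv he hf [p t] A /=; rewrite nbhsE /= => -[B [oB Bh] BA].
have chp : continuous (fun s => h (p, s)).
  have cs (X : topologicalType) (x : X) : continuous (fun s : R => (x, s)).
    by apply: cont_pair; [exact: cont_cst|exact: cont_id].
  case: (ptP p) => [[v pE]|[e [i pE]]|[f [d pE]]].
  - by rewrite pE; exact: hv.
  - rewrite pE -edgept_in; exact: (cont_comp (cs _ (val i)) (he e)).
  - rewrite pE -facept_in; exact: (cont_comp (cs _ (val d)) (hf f)).
have : nbhs t (fun s => B (h (p, s))) by apply: chp; exact: open_nbhs_nbhs.
move=> /nbhs_ballP [r /= r0 rB].
(* A compact neighbourhood of [t] inside the ball provided by continuity. *)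
pose J := `[t - r / 2, t + r / 2]%classic.
have cJ : compact J by exact: segment_compact.
have Jr s : J s -> ball t r s.
  rewrite /J /= in_itv /= /ball /= => /andP[h1 h2].
  by rewrite ltr_norml; apply/andP; split; lra.
exists ([set q | forall s, J s -> B (h (q, s))], J); last first.
  by move=> [q s] [/= qJ Js]; apply: BA; exact: qJ.
split=> /=.
  apply: open_nbhs_nbhs; split; last by move=> s /Jr; exact: rB.
  split=> [e|f].
    exact: (tube_open (he e) oB cJ).
  exact: (tube_open (hf f) oB cJ).
apply/nbhs_ballP; exists (r / 2) => /=; first lra.
move=> s; rewrite /ball /= ltr_norml => /andP[h1 h2].
by rewrite /J /= in_itv /=; apply/andP; split; lra.
Qed.

Lemma realization_compact : compact [set: T].
Proof.
pose C (d : {n : nat & cells K n}) := cell_char (R:=R) (projT2 d) @` disc R (projT1 d).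
have -> : [set: T] = \bigcup_(d in [set: {n : nat & cells K n}]) C d.
  apply/esym; rewrite predeqE => p; split=> // _; exists (cellof p) => //.
  by have [x xo xp] := cellof_pt p; exists x => //; exact: ltW.
rewrite -bigsetU_fset_set; last exact: finite_cells.
apply: bigsetU_compact => d _; apply: continuous_compact (@disc_compact _ _).
by apply: continuous_subspaceT; exact: cell_char_cont.
Qed.

(** Connectedness of the graph is stated as an induction principle on
    vertices. *)
Lemma realization_connected (v0 : vert K) :
  (forall P : vert K -> Prop, P v0 -> (forall e : edge K, P (src e) <-> P (tgt e)) -> forall v, P v) ->
  connected [set: T].
Proof.
move=> vind; pose C := connected_component [set: T] (Vx R v0).
have path (g : R -> T) a b : continuous g -> C (g a) -> C (g b).
  move=> cg Ca; apply: connected_component_trans Ca _.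
  have sub x y s : x <= s <= y -> (g @` `[x, y]%classic) (g s).
    by move=> xsy; exists s => //=; rewrite in_itv.
  have cc x y : connected (g @` `[x, y]%classic).
    by apply: connected_continuous_connected; [exact: segment_connected|exact: continuous_subspaceT].
  case: (lerP a b) => [ab|/ltW ab].
    by exists (g @` `[a, b]%classic); [split=> //; apply: (sub a b a)|apply: (sub a b b)]; rewrite lexx ab.
  by exists (g @` `[b, a]%classic); [split=> //; apply: (sub b a a)|apply: (sub b a b)]; rewrite lexx ab.
have cv v : C (Vx R v).
  apply: (vind (fun v => C (Vx R v))); first exact: connected_component_refl.
  move=> e; rewrite -edgept0 -edgept1; split; exact: (path _ _ _ (@edgept_cont K R e)).
have ce e s : C (edgept e s).
  by apply: (path _ 0 s (@edgept_cont K R e)); rewrite edgept0.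
have cg p : in_graph p -> C p.
  by case: (ptP p) => [[v ->]|[e [i ->]]|[f [d ->]]] // _; rewrite -edgept_in.
suff -> : [set: T] = C by exact: component_connected.
rewrite predeqE => p; split=> // _.
case: (ptP p) => [[v ->]|[e [i ->]]|[f [d ->]]]; [exact: cg|exact: cg|].
rewrite -facept_in; move: (val d) => [x y].
have := path (fun a => facept f (a * 1 + (1 - a) * x, (1 - a) * y)) 1 0.
rewrite subrr subr0 !mul0r !mul1r !add0r addr0; apply.
  apply: (cont_comp (f := fun a : R => (a * 1 + (1 - a) * x, (1 - a) * y))); last exact: facept_cont.
  by cont.
apply: cg; rewrite facept_ge1; first exact: att_graph.
by rewrite /rad /= expr1n expr0n addr0 sqrtr1.
Qed.

End Topology.

(** * Cellular maps and immersions *)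

Section Morphism.
Variables (K L : cell_data) (mv : vert K -> vert L) (me : edge K -> edge L) (mf : face K -> face L).
Hypothesis src_m : forall e, src (me e) = mv (src e).
Hypothesis tgt_m : forall e, tgt (me e) = mv (tgt e).
Hypothesis base_m : forall f, base (mf f) = mv (base f).
Hypothesis lo_m : forall f, lo (mf f) = map me (lo f).
Hypothesis hi_m : forall f, hi (mf f) = map me (hi f).
Variable R : realType.

Definition realize (p : realization K R) : realization L R :=
  match p with
  | inl (inl v) => Vx R (mv v)
  | inl (inr (e, i)) => Ed (me e) i
  | inr (f, d) => Fc (mf f) d
  end.

Lemma realize_edgept e s : realize (edgept e s) = edgept (me e) s.
Proof. by rewrite /edgept; case: insub => //=; rewrite src_m tgt_m; case: ifP. Qed.

Lemma walk_comp (E F T : Type) (m : E -> F) (eps : F -> R -> T) p es u :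
  walk (fun e => eps (m e)) p es u = walk eps p (map m es) u.
Proof. by elim: es p u => //= e es IH p u; rewrite IH. Qed.

Lemma realize_facept f z : realize (facept f z) = facept (mf f) z.
Proof.
have E : (fun e s => realize (edgept e s)) = (fun e => edgept (me e)).
  by apply/funext => e; apply/funext => s; exact: realize_edgept.
rewrite /facept; case: insub => //; rewrite /att (bigon_map realize) E /= base_m lo_m hi_m.
by rewrite /bigon !size_map !(@walk_comp _ _ _ me).
Qed.

Lemma realize_cont : continuous realize.
Proof.
apply: cont_from_cells => [e|f].
  by rewrite (_ : (fun s => _) = edgept (me e)); [exact: edgept_cont|apply/funext => s; exact: realize_edgept].
by rewrite (_ : (fun s => _) = facept (mf f)); [exact: facept_cont|apply/funext => s; exact: realize_facept].
Qed.

Definition map_cell n : cells K n -> cells L n :=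
  match n with 0 => mv | 1 => me | 2 => mf | _ => fun v => v end.

Lemma realize_char n (c : cells K n) x : realize (cell_char c x) = cell_char (map_cell c) x.
Proof. by case: n c x => [|[|[|[]]]] c x //=; [rewrite realize_edgept|rewrite realize_facept]. Qed.

Lemma realize_combinatorial : @combinatorial R (complex_of K R) (complex_of L R) realize.
Proof.
split; first exact: realize_cont.
move=> n c; exists (map_cell c); rewrite /open_cell /=.
have [_ [_ op]] := @char_map_homeo R (complex_of L R) n (map_cell c).
split; first by apply: continuous_subspaceT; exact: realize_cont.
split; first split.
- by move=> _ [x xo <-]; exists x => //; rewrite realize_char.
- move=> _ _ /set_mem [x xo <-] /set_mem [y yo <-]; rewrite !realize_char => xy.
  by congr cell_char; apply: (cell_char_inj (c := map_cell c)); rewrite ?inE.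
- by move=> _ [x xo <-]; exists (cell_char c x); [exists x|rewrite realize_char].
move=> V oV.
have [|W oW WE] := op (cell_char c @^-1` V).
  by apply: open_comp oV => x _; exact: cell_char_cont.
exists W => //; rewrite -WE; apply/seteqP; split=> p /=.
  by move=> [_ [[x xo <-] Vx] <-]; exists x; rewrite ?realize_char.
by move=> [x [xo Vx] <-]; exists (cell_char c x); rewrite ?realize_char //; split=> //; exists x.
Qed.

(** The pairs of points of different cells with the same coordinates and the
    same image form a compact set; by hypothesis it avoids the diagonal, and
    by injectivity on open cells it contains all pairs of distinct points with
    the same image. *)
Lemma realize_locally_injective :
  (forall n (c c' : cells K n), c <> c' -> map_cell c = map_cell c' ->
     forall x, disc R n x -> cell_char (R:=R) c x <> cell_char c' x) ->
  locally_injective realize.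
Proof.
move=> disj p.
pose I := {n : nat & (cells K n * cells K n)%type}.
(* The pairs of points with the same coordinates in a pair [i] of different cells
   with the same image. *)
pose D (i : I) : set (realization K R * realization K R) :=
  [set pq | [/\ (projT2 i).1 <> (projT2 i).2, map_cell (projT2 i).1 = map_cell (projT2 i).2
     & exists2 x, disc R (projT1 i) x & pq = (cell_char (projT2 i).1 x, cell_char (projT2 i).2 x)]].
have fI : finite_set [set: I].
  apply: (@sub_finite_set _ _ ((existT _ 0%N) @` [set: vert K * vert K] `|` (existT _ 1%N) @` [set: edge K * edge K] `|` (existT _ 2%N) @` [set: face K * face K])).
    by move=> [[|[|[|n]]] [c c']] _ //; [left; left|left; right|right]; exists (c, c').
  by rewrite !finite_setU; split; [split|]; apply: finite_image; exact: finite_finset.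
have cD i : closed (D i).
  case: i => n [c c'].
  have [[cc mm]|no] := pselect (c <> c' /\ map_cell c = map_cell c'); last first.
    by rewrite (_ : D _ = set0); [exact: closed0|rewrite -subset0 => pq [? ? _]; apply: no].
  rewrite (_ : D _ = (fun x => (cell_char (R:=R) c x, cell_char c' x)) @` disc R n).
    apply: compact_closed; first by apply: hausdorff_pair; exact: realization_hausdorff.
    apply: continuous_compact (@disc_compact _ _).
    by apply: continuous_subspaceT; apply: cont_pair; exact: cell_char_cont.
  by apply/seteqP; split=> [_ [_ _ [x xd ->]]|_ [x xd <-]]; [exists x|split=> //; exists x].
pose B := \bigcup_(i in [set: I]) D i.
have cB : closed B by apply: closed_bigcup => // i _; exact: cD.
have nB : nbhs (p, p) (~` B).
  apply: open_nbhs_nbhs; split; first exact: closed_openC.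
  by move=> [[n [c c']] _ [/= cc mm [x xd [px py]]]]; apply: (disj _ _ _ cc mm x xd); rewrite -px -py.
case: nB => -[U1 U2] [/= U1p U2p] UB.
exists (U1 `&` U2); first exact: filterI.
move=> q r /set_mem [U1q U2q] /set_mem [U1r U2r] qr; apply: contrapT => nqr.
apply: (UB (q, r)) => //=.
have [x xo xq] := cellof_pt q; have [y yo yr] := cellof_pt r.
have mq := congr1 (@cellof L R) qr.
rewrite -xq -yr !realize_char !cell_char_open // in mq.
move: mq x xo xq y yo yr; move: (cellof q) (cellof r) => [n c] [m c'] /= nm.
have e : n = m := congr1 (@projT1 _ _) nm.
case: m / e c' nm => c' nm x xo xq y yo yr.
have mm : map_cell c = map_cell c' by have := congr1 (tagged_as (existT _ n (map_cell c))) nm; rewrite !tagged_asE.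
have xy : x = y.
  by apply: (cell_char_inj (c := map_cell c)); rewrite ?inE // [in RHS]mm -!realize_char xq yr.
exists (existT _ n (c, c')) => //; rewrite /D /=; split=> //.
  by move=> cc; apply: nqr; rewrite -xq -yr cc xy.
by exists x; [exact: ltW|rewrite xq xy yr].
Qed.

(** The edge condition says that the map of graphs is an immersion. Two faces
    over the same one then differ at every boundary parameter, since their
    boundaries run at each time through distinct edges with the same image. *)
Lemma realize_immersion :
  (forall e e', e != e' -> me e = me e' -> src e <> src e' /\ tgt e <> tgt e') ->
  (forall f f', f != f' -> mf f = mf f' ->
     [/\ base f <> base f', all2 (fun e e' => e != e') (lo f) (lo f')
       & all2 (fun e e' => e != e') (hi f) (hi f')]) ->
  @immersion R (complex_of K R) (complex_of L R) realize.
Proof.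
move=> edisj fdisj; split; first exact: realize_combinatorial.
have sepE e e' (s : R) : e != e' -> me e = me e' -> edgept e s <> edgept e' s.
  move=> ee mm; have [ss tt] := edisj _ _ ee mm.
  case: (edgeptP e s) => [[s0 ->]|[s0 ->]|[i si ->]];
    case: (edgeptP e' s) => [[s0' ->]|[s0' ->]|[i' si' ->]] //.
  - by move=> [].
  - by have := le_trans s0' s0; rewrite ler10.
  - by have := le_trans s0 s0'; rewrite ler10.
  - by move=> [].
  - by move=> [/eqP]; rewrite (negPf ee).
have sepW es es' p p' (u : R) : all2 (fun e e' => e != e') es es' -> map me es = map me es' ->
    p <> p' -> walk (edgept (R:=R)) p es u <> walk (edgept (R:=R)) p' es' u.
  elim: es es' p p' u => [|e es IH] [|e' es'] //= p p' u /andP[ee aa] [mm mmm] pp.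
  by case: ifP => _; [exact: sepE|apply: IH => //; exact: sepE].
apply: realize_locally_injective => n c c' cc mm x _.
case: n c c' cc mm x => [|[|[|[]]]] // c c' cc mm x.
- by move=> [].
- by apply: sepE => //; exact/eqP.
have {}mm : mf c = mf c' := mm.
have /eqP/fdisj/(_ mm)[bb ll hh] := cc.
rewrite /=; case: (faceptP c (unrow2 x)) => [[r1 ->]|[d xd ->]].
  rewrite facept_ge1 // /att /bigon.
  have sizeE (s s' : seq (edge K)) : all2 (fun e e' => e != e') s s' -> size s = size s' by rewrite all2E => /andP[/eqP].
  rewrite -(sizeE _ _ ll) -(sizeE _ _ hh).
  case: ifP => _; apply: sepW => //.
  - by rewrite -!lo_m mm.
  - by move=> [].
  - by rewrite -!hi_m mm.
  - by move=> [].
by rewrite xd facept_in => E; apply: cc; case: E.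
Qed.

End Morphism.

(** * The abalone and the sphere over it *)

Local Notation la := false (only parsing).
Local Notation lb := true (only parsing).

(** Edges [a] and [b] are [la] and [lb]; the face [false] is A, with the
    relation a = 1, and the face [true] is W, with aba = bb. *)
Definition abalone : cell_data.
refine (@CellData unit bool bool (fun _ => tt) (fun _ => tt) (fun _ => tt)
  (fun f => if f then [:: la; lb; la] else [:: la])
  (fun f => if f then [:: lb; lb] else [::]) _ _ _).
- by case.
- by case.
- by case.
Defined.

Section Sphere.
Variable Z : finType.

Let V := (bool * bool)%type.
Let E := (option bool + option bool + Z)%type.
Let a0 : E := inl (inl (Some false)).
Let a12 : E := inl (inl None).
Let a3 : E := inl (inl (Some true)).
Let b01 : E := inl (inr (Some false)).
Let b12 : E := inl (inr None).
Let b23 : E := inl (inr (Some true)).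
Let v0 : V := (false, false).
Let v1 : V := (false, true).
Let v2 : V := (true, false).
Let v3 : V := (true, true).

Definition sphere_src (e : E) : V :=
  match e with
  | inl (inl None) => v1 | inl (inl (Some false)) => v0 | inl (inl (Some true)) => v3
  | inl (inr None) => v1 | inl (inr (Some false)) => v0 | inl (inr (Some true)) => v2
  | inr _ => v3
  end.

Definition sphere_tgt (e : E) : V :=
  match e with
  | inl (inl None) => v2 | inl (inl (Some false)) => v0 | inl (inl (Some true)) => v3
  | inl (inr None) => v2 | inl (inr (Some false)) => v1 | inl (inr (Some true)) => v3
  | inr _ => v0
  end.

(** The faces [(false, _)] lie over A, and the faces [(true, _)] over W. The
    elements of [Z] are additional edges from [v3] to [v0]. *)
Definition sphere_data : cell_data.
refine (@CellData V E (bool * bool)%type sphere_src sphere_tgt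
  (fun f => match f with (false, false) => v0 | (false, true) => v3 | (true, false) => v0 | (true, true) => v1 end)
  (fun f => match f with (false, false) => [:: a0] | (false, true) => [:: a3]
            | (true, false) => [:: a0; b01; a12] | (true, true) => [:: a12; b23; a3] end)
  (fun f => match f with (false, _) => [::] | (true, false) => [:: b01; b12] | (true, true) => [:: b12; b23] end)
   _ _ _).
- by case=> [[] []].
- by case=> [[] []].
- by case=> [[] []].
Defined.

Definition label (e : E) : bool := if e is inl (inl _) then la else lb.

Definition sphere_map (R : realType) : realization sphere_data R -> realization abalone R :=
  @realize sphere_data abalone (fun _ => tt) label (fun f => f.1) R.

Lemma sphere_immersion (R : realType) : (forall z z' : Z, z = z') ->
  @immersion R (complex_of sphere_data R) (complex_of abalone R) (@sphere_map R).
Proof.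
move=> subs; apply: realize_immersion => //.
- by case=> [[] []].
- by case=> [[] []].
- move=> [[[[]|]|[[]|]]|z] [[[[]|]|[[]|]]|z'] //= + _; rewrite ?eqxx //.
  by rewrite (subs z z') eqxx.
- by move=> [[] []] [[] []].
Qed.

Lemma sphere_compact (R : realType) : compact [set: complex_of sphere_data R].
Proof. exact: realization_compact. Qed.

Lemma sphere_connected (R : realType) : connected [set: complex_of sphere_data R].
Proof.
apply: (@realization_connected sphere_data R v0) => P P0 PE.
have P1 : P v1 by apply/(PE b01).
have P2 : P v2 by apply/(PE b12).
have P3 : P v3 by apply/(PE b23).
by case=> [[] []].
Qed.

Lemma sphere_euler (R : realType) : euler_char (complex_of sphere_data R) = 2 - #|Z|%:Z.
Proof.
rewrite euler_complex_of /= !card_sum !card_option !card_prod !card_bool.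
by rewrite PoszD; ring.
Qed.

End Sphere.

(** * The circle *)

Section Circle.
Context {R : realType}.
Implicit Types s t x : R.

Definition clamp s : R := Num.max 0 (Num.min 1 s).

Lemma clamp_cont (S : topologicalType) (f : S -> R) : continuous f -> continuous (fun y => clamp (f y)).
Proof. by move=> cf; rewrite /clamp; cont. Qed.

Lemma clamp_in s : 0 <= s <= 1 -> clamp s = s.
Proof. by move=> /andP[s0 s1]; rewrite /clamp min_r // max_r. Qed.

Lemma clamp_le0 s : s <= 0 -> clamp s = 0.
Proof. by move=> s0; rewrite /clamp max_l // ge_min s0 orbT. Qed.

Lemma clamp_ge1 s : 1 <= s -> clamp s = 1.
Proof. by move=> s1; rewrite /clamp min_l // max_r. Qed.

Lemma clamp_bound s : 0 <= clamp s <= 1.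
Proof. by rewrite /clamp le_max lexx /= ge_max ler01 ge_min lexx. Qed.

Lemma clip_bound x : -1 <= Num.max (-1) (Num.min 1 x) <= 1.
Proof. rewrite le_max lexx /= ge_max ge_min lexx /= andbT; lra. Qed.

(** The angle between 0 and pi with a given cosine, as a fraction of a full
    turn. *)
Definition turn x : R := acos (Num.max (-1) (Num.min 1 x)) / (pi *+ 2).

Lemma pi2_neq0 : (pi : R) *+ 2 != 0.
Proof. by rewrite mulrn_eq0 /= gt_eqF // pi_gt0. Qed.

Lemma turn_cont : continuous turn.
Proof.
rewrite /turn; apply: contM; last by cont.
have ca : {within `[(-1 : R), 1], continuous (@acos R)}.
  rewrite -[X in `[X, _]%classic]cospi -[X in `[_, X]%classic]cos0.
  apply: segment_can_ge_continuous; first exact: pi_ge0.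
    by apply: continuous_subspaceT; exact: continuous_cos.
  exact: cosK.
have cm : continuous (fun x : R => Num.max (-1) (Num.min 1 x)) by cont.
move=> x A.
have inI y : `[(-1 : R), 1]%classic (Num.max (-1) (Num.min 1 y)).
  by rewrite /= in_itv /=; exact: clip_bound.
move/subspace_continuousP: ca => /(_ _ (inI x)) ca /ca /= wA.
have := cm x _ wA; rewrite /= nbhs_simpl /=; apply: filterS => y; apply; exact: inI.
Qed.

Lemma turn1 : turn 1 = 0.
Proof. by rewrite /turn min_l // max_r ?acos1 ?mul0r //; lra. Qed.

Lemma turnN1 : turn (-1) = 2^-1.
Proof.
rewrite /turn min_r; last lra.
rewrite max_l // acosN1; apply: (mulIf pi2_neq0); rewrite divfK ?pi2_neq0 // -mulr_natr; lra.
Qed.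

Lemma turn_bound x : 0 <= turn x <= 2^-1.
Proof.
have b : -1 <= Num.max (-1) (Num.min 1 x) <= 1.
  exact: clip_bound.
have p := pi_gt0 R.
have p2 : (0 : R) < pi *+ 2 by rewrite pmulrn_lgt0.
rewrite /turn ler_pdivlMr // mul0r ler_pdivrMr // acos_ge0 //=.
by rewrite -mulr_natr [X in _ <= X](_ : _ = pi) ?acos_lepi //; lra.
Qed.

(** The unit circle, run clockwise from [(1, 0)], once in unit time: the lower
    half-circle comes first. *)
Definition eta s : R * R := (cos (s * (pi *+ 2)), - sin (s * (pi *+ 2))).

Lemma eta_cont (S : topologicalType) (f : S -> R) : continuous f -> continuous (fun y => eta (f y)).
Proof. by move=> cf; rewrite /eta; cont. Qed.

Lemma eta1 s : eta (s + 1) = eta s.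
Proof. by rewrite /eta mulrDl mul1r cosD2pi sinD2pi. Qed.

Lemma eta0 : eta 0 = (1, 0).
Proof. by rewrite /eta mul0r cos0 sin0 oppr0. Qed.

Lemma rad_eta s : rad (eta s) = 1.
Proof. by rewrite /rad /= sqrrN cos2Dsin2 sqrtr1. Qed.

Lemma turn_eta s : 0 <= s <= 2^-1 -> turn (eta s).1 = s.
Proof.
move=> /andP[s0 s1]; rewrite /turn /= min_r ?cos_le1 // max_r ?cos_geN1 //.
have p := pi_gt0 R.
rewrite cosK; first by rewrite mulfK // pi2_neq0.
rewrite in_itv /= -mulr_natr.
by have := ler_wpM2r (ltW p) s1; have := mulr_ge0 s0 (ltW p); lra.
Qed.

Lemma eta_neg s : 0 <= s <= 2^-1 -> (eta s).2 <= 0.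
Proof.
move=> /andP[s0 s1]; rewrite /= oppr_le0 sin_ge0_pi //; have p := pi_gt0 R.
rewrite -mulr_natr.
by have := ler_wpM2r (ltW p) s1; have := mulr_ge0 s0 (ltW p); lra.
Qed.

Lemma etaN s : eta (1 - s) = ((eta s).1, - (eta s).2).
Proof. by rewrite -[1 - s]addrC eta1 /eta mulNr cosN sinN. Qed.

Lemma eta_pos s : 2^-1 <= s <= 1 -> 0 <= (eta s).2.
Proof.
move=> h; rewrite (_ : s = 1 - (1 - s)); last lra.
by rewrite etaN /= -(@oppr_le0 _ (- _)) opprK; have := @eta_neg (1 - s); rewrite /=; apply; lra.
Qed.

Lemma turn_eta' s : 2^-1 <= s <= 1 -> 1 - turn (eta s).1 = s.
Proof.
move=> h; rewrite {1}(_ : s = 1 - (1 - s)); last lra.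
by rewrite etaN /= -/(eta (1 - s)).1 turn_eta; lra.
Qed.

Lemma eta_turn z : rad z = 1 -> eta (if z.2 <= 0 then turn z.1 else 1 - turn z.1) = z.
Proof.
move=> r1; have zz : z.1 ^+ 2 + z.2 ^+ 2 = 1 by rewrite -sqr_rad r1 expr1n.
have b : -1 <= z.1 <= 1 by rewrite -(dirx_unit r1); exact: dirx_bound.
have et : eta (turn z.1) = (z.1, - `|z.2|).
  rewrite /eta /turn min_r; last by case/andP: b.
  rewrite max_r; last by case/andP: b.
  rewrite divfK ?pi2_neq0 // acosK // sin_acos //.
  by rewrite (_ : 1 - z.1 ^+ 2 = z.2 ^+ 2) ?sqrtr_sqr //; lra.
case: ifP => z2; rewrite ?etaN et /=.
  by rewrite ler0_norm // opprK; case: z {r1 zz b et z2}.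
by rewrite opprK gtr0_norm ?ltNge ?z2 //; case: z {r1 zz b et z2}.
Qed.

(** With [upper], the homotopy of loops given on the lower half-circle and on
    the upper one by [eta (lower t x)] and [eta (upper t x)]. At [t = 0] it
    reads the relation b = bb: the middle third of the lower side and each
    half of the upper side run once around the circle. At [t = 1] it is the
    identity of the circle. The lifts agree at [x = -1] and differ by a full
    turn at [x = 1]. *)
Definition lower t x : R := (1 - t) * clamp ((3 * x + 1) / 2) + t * turn x.
Definition upper t x : R := (1 - t) * (x + 1) + t * (1 - turn x).

Lemma lower_cont (S : topologicalType) (f g : S -> R) : continuous f -> continuous g -> continuous (fun y => lower (f y) (g y)).
Proof.
move=> cf cg; have c1 := cont_comp cg turn_cont.
have c2 : continuous (fun y => clamp ((3 * g y + 1) / 2)) by apply: clamp_cont; cont.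
by rewrite /lower; cont.
Qed.

Lemma upper_cont (S : topologicalType) (f g : S -> R) : continuous f -> continuous g -> continuous (fun y => upper (f y) (g y)).
Proof. by move=> cf cg; have c1 := cont_comp cg turn_cont; rewrite /upper; cont. Qed.

Lemma lower_bound t x : 0 <= t <= 1 -> 0 <= lower t x <= 1.
Proof.
move=> /andP[t0 t1]; rewrite /lower; have := clamp_bound ((3 * x + 1) / 2).
by have := turn_bound x => /andP[h1 h2] /andP[h3 h4]; apply/andP; split; nra.
Qed.

Lemma upper_bound t x : 0 <= t <= 1 -> -1 <= x <= 1 -> 0 <= upper t x <= 2.
Proof.
move=> /andP[t0 t1] /andP[x0 x1]; rewrite /upper.
by have := turn_bound x => /andP[h1 h2]; apply/andP; split; nra.
Qed.

Lemma lowerN1 t : lower t (-1) = upper t (-1).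
Proof. by rewrite /lower /upper turnN1 clamp_le0; lra. Qed.

Lemma upper1 t : upper t 1 = lower t 1 + 1.
Proof. by rewrite /lower /upper turn1 clamp_ge1; lra. Qed.

End Circle.

(** * The abalone is contractible *)

Section Contraction.
Variable R : realType.
Local Notation T := (realization abalone R).
Local Notation edgeX := (@edgept abalone R).
Local Notation faceX := (@facept abalone R).
Local Notation fA := (false : face abalone).
Local Notation fW := (true : face abalone).
Local Notation ea := (false : edge abalone).
Local Notation eb := (true : edge abalone).
Local Notation v := (Vx R (tt : vert abalone)).
Implicit Types (s t u x : R) (z y : R * R).

Lemma attA z : att fA z = if z.2 <= 0 then edgeX ea ((dirx 0 z + 1) / 2) else v.
Proof.
rewrite /att /bigon /=; case: ifP => // _; rewrite mul1r ifT //.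
by have := dirx_bound z; lra.
Qed.

Lemma edgeX0 e s : s <= 0 \/ 1 <= s -> edgeX e s = v.
Proof. by case=> h; [rewrite edgept_le0|rewrite edgept_ge1]. Qed.

(** For [t] from 0 to 1, a vertical segment of the unit disc is followed from
    bottom to top. *)
Definition chord x t : R * R := (x, (2 * t - 1) * Num.sqrt (1 - x ^+ 2)).

(** The loop a is moved to the constant loop across the disc A, and b is not
    moved. The vertical motion keeps the ends of the loop at the vertex. *)
Definition push t (e : edge abalone) s : T := if e then edgeX eb s else faceX fA (chord (2 * s - 1) t).

Arguments push : simpl never.

Lemma push_out t e s : s <= 0 \/ 1 <= s -> push t e s = v.
Proof.
move=> h; rewrite /push; case: e; first by exact: edgeX0.
have x1 : 1 <= (2 * s - 1) ^+ 2 by rewrite expr2; case: h => h; nra.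
have E : chord (2 * s - 1) t = (2 * s - 1, 0) by rewrite /chord ler0_sqrtr ?mulr0 //; lra.
have r1 : 1 <= rad (chord (2 * s - 1) t).
  by rewrite E leNgt rad_lt1 /= expr0n addr0 -leNgt.
rewrite facept_ge1 // attA -(dirx_ge r1) E /= lexx.
have [->|->] := dirx_axis (z := (2 * s - 1, 0)) ltr01 (eq_ind _ (fun z => 1 <= rad z) r1 _ E) erefl.
  by rewrite edgeX0 //; right; lra.
by rewrite edgeX0 //; left; lra.
Qed.

Lemma push0 e s : push 0 e s = edgeX e s.
Proof.
have [s0|s0] := lerP s 0; first by rewrite push_out ?edgeX0 //; left.
have [s1|s1] := lerP 1 s; first by rewrite push_out ?edgeX0 //; right.
case: e => //; rewrite /push.
have x1 : 0 < 1 - (2 * s - 1) ^+ 2 by rewrite expr2; nra.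
have r1 : rad (chord (2 * s - 1) 0) = 1.
  by rewrite /rad /chord /= mulr0 sub0r mulN1r sqrrN sqr_sqrtr ?(ltW x1) // addrC subrK sqrtr1.
rewrite facept_ge1 ?r1 // attA dirx_unit // ifT; first by congr edgept; rewrite /chord /=; lra.
by rewrite /chord /= mulr0 sub0r mulN1r oppr_le0 sqrtr_ge0.
Qed.

Lemma faceA_top x : faceX fA (x, Num.sqrt (1 - x ^+ 2)) = v.
Proof.
set z := (x, _).
have r1 : 1 <= rad z.
  rewrite leNgt rad_lt1 /= -leNgt; case: (lerP 0 (1 - x ^+ 2)) => h.
    by rewrite sqr_sqrtr // addrC subrK.
  by rewrite ler0_sqrtr ?(ltW h) // expr0n addr0; lra.
rewrite facept_ge1 // attA /=; case: ifP => // z2.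
have z20 : z.2 = 0 by apply/eqP; rewrite eq_le z2 sqrtr_ge0.
rewrite -(dirx_ge r1); have [->|->] := dirx_axis ltr01 r1 z20.
  by rewrite edgeX0 //; right; lra.
by rewrite edgeX0 //; left; lra.
Qed.

Lemma push1 e s : push 1 e s = if e then edgeX eb s else v.
Proof. by case: e => //; rewrite /push /chord (_ : 2 * 1 - 1 = 1) ?mul1r ?faceA_top //; lra. Qed.

Lemma push_cont (S : topologicalType) (f g : S -> R) e : continuous f -> continuous g ->
  continuous (fun w => push (f w) e (g w)).
Proof.
move=> cf cg; rewrite /push; case: e; first exact: cont_comp cg (@edgept_cont _ _ _).
apply: (cont_comp (f := fun w => chord (2 * g w - 1) (f w))); last exact: facept_cont.
by rewrite /chord; cont.
Qed.

Lemma push_linked t (es : seq (edge abalone)) : linked (push t) v es.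
Proof.
by elim: es => //= e es IH; rewrite !push_out; [split|right|left].
Qed.

(** The loop b run twice, so that any lift between 0 and 2 of a point of the
    circle can be used as parameter. *)
Definition bb s : T := walk edgeX v [:: eb; eb] s.

Lemma bb_cont (S : topologicalType) (f : S -> R) : continuous f -> continuous (fun w => bb (f w)).
Proof.
move=> cf; rewrite /bb; apply: (@walk_cont R _ S T (fun _ => edgeX) _ (fun _ => v)) => //.
- by move=> e; apply: (cont_comp (@cont_snd _ _)); exact: edgept_cont.
- exact: cont_cst.
- by move=> _; apply: chain_linked.
Qed.

Lemma bb1 s : 0 <= s <= 1 -> bb (s + 1) = bb s.
Proof.
move=> /andP[s0 s1]; rewrite /bb /= addrK !subr_le0 s1.
have [->|sn] := eqVneq s 0; first by rewrite lexx add0r !edgeX0 //; [left|right].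
by rewrite leNgt lt_neqAle eq_sym sn s0 /=.
Qed.

Lemma bb_in s : s <= 1 -> bb s = edgeX eb s.
Proof. by move=> s1; rewrite /bb /= subr_le0 s1. Qed.

Lemma push1_walk u : walk (push 1) v [:: ea; eb; ea] u = bb (clamp (u - 1)).
Proof.
rewrite /= !push1 /=; case: (lerP (u - 1) 0) => u1.
  by rewrite clamp_le0 // bb_in ?ler01 // edgeX0 //; left.
case: (lerP (u - 1 - 1) 0) => u2.
  by rewrite clamp_in ?bb_in //; lra.
rewrite clamp_ge1; last lra.
by rewrite bb_in // edgeX0; [case: ifP|right].
Qed.

(** Lower half of the collars: up to radius 2, the letters a of aba are pushed
    across A; beyond it, the loop given by b on one side and bb on the other
    is turned into a single loop. *)
Definition unroll_low y : T :=
  if rad y - 2 <= 0 then walk (push (rad y - 1)) v [:: ea; eb; ea] (3 * ((dirx 1 y + 1) / 2))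
  else bb (lower (clamp (rad y - 2)) (dirx 1 y)).
(** Upper half of the collars: [upper] starts at the path bb, which stays in
    place up to radius 2. *)
Definition unroll_up y : T := bb (upper (clamp (rad y - 2)) (dirx 1 y)).
Definition unroll y : T :=
  if rad y - 1 <= 0 then faceX fW y else if y.2 <= 0 then unroll_low y else unroll_up y.

Lemma cont_rad : continuous (@rad R).
Proof. exact: (@rad_cont R _ id (@cont_id _)). Qed.

Lemma cont_dirx c : 0 < c -> continuous (@dirx R c).
Proof. by move=> c0; exact: (@dirx_cont R _ c id c0 (@cont_id _)). Qed.

Lemma unroll_low_cont : continuous unroll_low.
Proof.
have cr := cont_rad; have cd := cont_dirx ltr01.
apply: cont_if; first by cont.
- apply: (@walk_cont R _ _ T (fun y => push (rad y - 1)) _ (fun _ => v)).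
  + move=> e; apply: (@push_cont _ (fun yu => rad yu.1 - 1) snd e); cont.
  + exact: cont_cst.
  + by cont.
  + by move=> y; exact: push_linked.
- by apply: bb_cont; apply: lower_cont => //; apply: clamp_cont; cont.
- move=> y r2; rewrite r2 (_ : rad y - 1 = 1); last lra.
  rewrite push1_walk (@clamp_le0 _ 0) // /lower subr0 mul1r mul0r addr0; congr (bb (clamp _)); lra.
Qed.

Lemma unroll_up_cont : continuous unroll_up.
Proof.
have cr := cont_rad; have cd := cont_dirx ltr01.
by apply: bb_cont; apply: upper_cont => //; apply: clamp_cont; cont.
Qed.

Lemma unroll_low1 y : rad y <= 2 -> unroll_low y = walk (push (rad y - 1)) v [:: ea; eb; ea] (3 * ((dirx 1 y + 1) / 2)).
Proof. by move=> r2; rewrite /unroll_low subr_le0 r2. Qed.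

Lemma unroll_low2 y : 2 <= rad y -> unroll_low y = bb (lower (clamp (rad y - 2)) (dirx 1 y)).
Proof.
rewrite /unroll_low subr_le0; case: (ltgtP (rad y) 2) => // r2 _.
rewrite r2 (_ : 2 - 1 = 1 :> R); last lra.
rewrite push1_walk subrr (@clamp_le0 _ 0) // /lower subr0 mul1r mul0r addr0; congr (bb (clamp _)); lra.
Qed.

Lemma unroll_up1 y : rad y <= 2 -> unroll_up y = bb (dirx 1 y + 1).
Proof. by move=> r2; rewrite /unroll_up clamp_le0 ?subr_le0 // /upper subr0 mul1r mul0r addr0. Qed.

Lemma axis_bb t x : 0 <= t <= 1 -> x = 1 \/ x = -1 -> bb (lower t x) = bb (upper t x).
Proof.
by move=> t01 [->|->]; [rewrite upper1 bb1 //; exact: lower_bound|rewrite lowerN1].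
Qed.

Lemma unroll_axis y : 1 <= rad y -> y.2 = 0 -> unroll_low y = unroll_up y.
Proof.
move=> r1 y2; have dx := dirx_axis ltr01 r1 y2.
case: (lerP (rad y) 2) => [r2|/ltW r2]; last by rewrite unroll_low2 //; apply: axis_bb dx; exact: clamp_bound.
rewrite unroll_low1 // unroll_up1 //; case: dx => ->.
  have -> : walk (push (rad y - 1)) v [:: ea; eb; ea] (3 * ((1 + 1) / 2)) = walk_end (push (rad y - 1)) v [:: ea; eb; ea].
    by rewrite -(walk_size (push_linked _ _)); congr walk => /=; lra.
  by rewrite /walk_end /= push_out; [rewrite bb1 ?bb_in ?edgeX0 //; [right|rewrite lexx ler01]|right].
rewrite !addNr mul0r mulr0 walk0; last exact: push_linked.
by rewrite bb_in ?ler01 // edgeX0 //; left.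
Qed.

Lemma faceW_low y : 1 <= rad y -> y.2 <= 0 -> faceX fW y = walk edgeX v [:: ea; eb; ea] (3 * ((dirx 1 y + 1) / 2)).
Proof. by move=> r1 y2; rewrite facept_ge1 // /att /bigon y2 dirx_ge. Qed.

Lemma bb_walk x : walk edgeX v [:: eb; eb] (2 * ((x + 1) / 2)) = bb (x + 1).
Proof. by congr walk; lra. Qed.

Lemma faceW_axis y : 1 <= rad y -> y.2 = 0 ->
  walk edgeX v [:: ea; eb; ea] (3 * ((dirx 1 y + 1) / 2)) = bb (dirx 1 y + 1).
Proof.
move=> r1 y2; rewrite -bb_walk.
exact: (@bigon_axis R _ _ edgeX v [:: ea; eb; ea] [:: eb; eb] 1 y (@lo_linked abalone R fW) (@hi_linked abalone R fW) (@lohi_end abalone R fW) ltr01 r1 y2).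
Qed.

Lemma faceW_up y : 1 <= rad y -> 0 <= y.2 -> faceX fW y = bb (dirx 1 y + 1).
Proof.
move=> r1 y2; have [y0|y0] := lerP y.2 0.
  by rewrite faceW_low // faceW_axis //; apply/eqP; rewrite eq_le y0.
by rewrite facept_ge1 // /att /bigon [y.2 <= 0]leNgt y0 -bb_walk dirx_ge.
Qed.

Lemma walk_push0 p es u : walk (push 0) p es u = walk edgeX p es u.
Proof. by congr (walk _ p es u); apply/funext => e; apply/funext => s; exact: push0. Qed.

Lemma unroll_in y : rad y <= 1 -> unroll y = faceX fW y.
Proof. by move=> r; rewrite /unroll subr_le0 r. Qed.

Lemma unroll_lowE y : 1 <= rad y -> y.2 <= 0 -> unroll y = unroll_low y.
Proof.
rewrite /unroll subr_le0 => + y2; rewrite y2; case: (ltgtP (rad y) 1) => // r1 _.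
rewrite faceW_low ?r1 // unroll_low1 ?r1 ?subrr ?walk_push0 //; lra.
Qed.

Lemma unroll_upE y : 1 <= rad y -> 0 <= y.2 -> unroll y = unroll_up y.
Proof.
move=> r1 y2; have [y0|y0] := lerP y.2 0.
  by rewrite unroll_lowE // unroll_axis //; apply/eqP; rewrite eq_le y0.
rewrite /unroll subr_le0 [y.2 <= 0]leNgt y0 /=; case: (ltgtP (rad y) 1) r1 => // r1 _.
by rewrite faceW_up ?r1 // unroll_up1 ?r1 //; lra.
Qed.

Lemma unroll_cont : continuous unroll.
Proof.
have cr := cont_rad.
apply: (@cont_glue R _ _ (fun y => rad y - 1) snd unroll (faceX fW) unroll_low unroll_up).
- by cont.
- by cont.
- exact: facept_cont.
- exact: unroll_low_cont.
- exact: unroll_up_cont.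
- by move=> y; rewrite subr_le0 => r; rewrite unroll_in.
- by move=> y; rewrite subr_ge0 => r y2; rewrite unroll_lowE.
- by move=> y; rewrite subr_ge0 => r y2; rewrite unroll_upE.
Qed.

(** The vertical motion of the disc A to its upper side, which is at the
    vertex. *)
Definition slideA z t : T := faceX fA (z.1, (1 - t) * z.2 + t * Num.sqrt (1 - z.1 ^+ 2)).
(** The factor by which the homotopy scales the point [z] of W. At [t = 1] the
    radius goes up from 0 to 3 on the inner half of the disc and back to 2 on
    the outer half; on the boundary it is [1 + t] at all times, so the
    boundary moves as [push] says. *)
Definition stretch z t : R := (1 - t) + t * (4 / Num.max 2^-1 (rad z) - 2).
Definition slideW z t : T := unroll (stretch z t *: z).

Definition slide (p : T) t : T :=
  match p with
  | inl (inl _) => v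
  | inl (inr (e, i)) => push t e (val i)
  | inr (f, d) => if f then slideW (val d) t else slideA (val d) t
  end.

Lemma slide_edge e s t : slide (edgeX e s) t = push t e s.
Proof.
case: (edgeptP e s) => [[s0 ->]|[s1 ->]|[i -> ->]] //=.
  by rewrite push_out //; left.
by rewrite push_out //; right.
Qed.

Lemma rad_to_disc1 z : 1 <= rad z -> rad (to_disc z) = 1.
Proof. by move=> r; rewrite rad_to_disc min_l. Qed.

Lemma att_to_disc (f : face abalone) z : 1 <= rad z -> faceX f z = att f (to_disc z).
Proof. by move=> r; rewrite facept_to_disc facept_ge1 // rad_to_disc1. Qed.

Lemma unit_snd z : rad z = 1 -> Num.sqrt (1 - z.1 ^+ 2) = `|z.2|.
Proof.
move=> r; have := sqr_rad z; rewrite r expr1n => h.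
by rewrite (_ : 1 - z.1 ^+ 2 = z.2 ^+ 2) ?sqrtr_sqr //; lra.
Qed.

Lemma slide_A z t : slide (faceX fA z) t = slideA (to_disc z) t.
Proof.
case: (faceptP fA z) => [[r1 _]|[d -> ->]] /=; last by rewrite to_disc_in //; exact/ltW/(valP d).
have u1 := rad_to_disc1 r1; rewrite att_to_disc // attA /slideA unit_snd //.
case: ifP => z2.
  rewrite slide_edge /push /chord dirx_unit // (_ : 2 * ((_ + 1) / 2) - 1 = (to_disc z).1); last lra.
  rewrite unit_snd // ler0_norm //; congr (faceX fA (_, _)); lra.
rewrite gtr0_norm ?ltNge ?z2 // -mulrDl subrK mul1r.
have := faceA_top (to_disc z).1; rewrite unit_snd // gtr0_norm ?ltNge ?z2 // => ->.
Qed.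

Lemma walk_eq (E : Type) (eps eps' : E -> R -> T) p es u : (forall e s, eps e s = eps' e s) ->
  walk eps p es u = walk eps' p es u.
Proof. by move=> h; rewrite (_ : eps = eps') //; apply/funext => e; apply/funext => s. Qed.

Lemma stretch_unit z t : rad z = 1 -> stretch z t = 1 + t.
Proof. by move=> r; rewrite /stretch r max_r; lra. Qed.

Lemma slide_W z t : 0 <= t <= 1 -> slide (faceX fW z) t = slideW (to_disc z) t.
Proof.
move=> /andP[t0 t1].
case: (faceptP fW z) => [[r1 _]|[d -> ->]] /=; last by rewrite to_disc_in //; exact/ltW/(valP d).
have u1 := rad_to_disc1 r1; rewrite att_to_disc // /slideW stretch_unit //.
have tp : 0 < 1 + t by lra.
have rt : rad ((1 + t) *: to_disc z) = 1 + t by rewrite radZ ?ltW // u1 mulr1.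
have dE : dirx 1 ((1 + t) *: to_disc z) = dirx 0 (to_disc z) by rewrite dirx_ge; [exact: dirxZ|rewrite rt; lra].
rewrite /att /bigon; case: ifP => z2.
  rewrite unroll_lowE ?rt; [|lra|by rewrite /= pmulr_rle0].
  rewrite unroll_low1 rt; last lra.
  rewrite dE (_ : 1 + t - 1 = t); last lra.
  by rewrite (walk_map (fun p => slide p t)); apply: walk_eq => e s; exact: slide_edge.
rewrite unroll_upE ?rt; [|lra|by rewrite /= mulr_ge0 ?ltW // ltNge z2].
rewrite unroll_up1; last lra.
rewrite dE -bb_walk (walk_map (fun p => slide p t)).
by rewrite (@walk_eq _ _ (push t)) // => e s; exact: slide_edge.
Qed.

Lemma unroll_scale_cont (S : topologicalType) (f : S -> R) (g : S -> R * R) :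
  continuous f -> continuous g -> continuous (fun w => unroll (f w *: g w)).
Proof.
move=> cf cg; have c1 := cont_comp cg (@cont_fst _ _); have c2 := cont_comp cg (@cont_snd _ _).
apply: (cont_comp (f := fun w => f w *: g w)); last exact: unroll_cont.
by apply: (@cont_pair _ _ _ (fun w => f w * (g w).1) (fun w => f w * (g w).2)); cont.
Qed.

Lemma slide_cont : continuous (fun pt : T * R => slide pt.1 (clamp pt.2)).
Proof.
have cc : continuous (fun w : R * R => clamp w.2) by apply: clamp_cont; cont.
have cc' : continuous (fun w : (R * R) * R => clamp w.2) by apply: clamp_cont; cont.
have cp : continuous (fun w : (R * R) * R => to_disc w.1) by apply: (cont_comp (@cont_fst _ _)); exact: to_disc_cont.
apply: cont_from_cells_cyl => [w|e|f]; first exact: cont_cst.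
- rewrite (_ : (fun st => _) = (fun st : R * R => push (clamp st.2) e st.1)).
    by apply: push_cont => //; cont.
  by apply/funext => st; rewrite slide_edge.
- have c1 := cont_comp cp (@cont_fst _ _); have c2 := cont_comp cp (@cont_snd _ _).
  case: f.
    rewrite (_ : (fun zt => _) = (fun zt : (R * R) * R => slideW (to_disc zt.1) (clamp zt.2))).
      apply: unroll_scale_cont => //; rewrite /stretch; have cr := rad_cont cp.
      apply: contD; first by cont.
      apply: contM => //; apply: contD; last by cont.
      apply: contM; first by cont.
      by apply: contV; [move=> x; rewrite gt_eqF // lt_max; apply/orP; left; lra|cont].
    by apply/funext => zt; rewrite slide_W // clamp_bound.
  rewrite (_ : (fun zt => _) = (fun zt : (R * R) * R => slideA (to_disc zt.1) (clamp zt.2))).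
    apply: (cont_comp (f := fun zt : (R * R) * R => ((to_disc zt.1).1, (1 - clamp zt.2) * (to_disc zt.1).2 + clamp zt.2 * Num.sqrt (1 - (to_disc zt.1).1 ^+ 2)))); last exact: facept_cont.
    by cont.
  by apply/funext => zt; rewrite slide_A.
Qed.

Lemma slide0 p : slide p 0 = p.
Proof.
case: (ptP p) => [[[] ->]|[e [i ->]]|[[] [d ->]]] //=.
- by rewrite push0 edgept_in.
- rewrite /slideW /stretch subr0 mul0r addr0 scale1r unroll_in ?facept_in //; exact/ltW/(valP d).
- by rewrite /slideA subr0 mul1r mul0r addr0 -surjective_pairing facept_in.
Qed.

Definition eta3 s : R * R := 3 *: eta s.
Definition flatW z : R * R :=
  if rad z - 2^-1 <= 0 then 6 *: z
  else let t := 2 - 2 * Num.min 1 (rad z) in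
       eta3 (if z.2 <= 0 then lower t (dirx 2^-1 z) else upper t (dirx 2^-1 z)).

(** A goes to the point of the circle of radius 3 that stands for the vertex,
    b goes around that circle, and W is spread over the disc of radius 3, with
    its collar sent to the circle by the homotopy [lower], [upper] run
    backwards. *)
Definition flat (p : T) : R * R :=
  match p with
  | inl (inr (e, i)) => if e then eta3 (val i) else eta3 0
  | inr (f, d) => if f then flatW (val d) else eta3 0
  | _ => eta3 0
  end.

Lemma eta3_1 s : eta3 (s + 1) = eta3 s. Proof. by rewrite /eta3 eta1. Qed.

Lemma eta3_cont (S : topologicalType) (f : S -> R) : continuous f -> continuous (fun w => eta3 (f w)).
Proof.
move=> cf; have ce := eta_cont cf.
have c1 := cont_comp ce (@cont_fst _ _); have c2 := cont_comp ce (@cont_snd _ _).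
by apply: (@cont_pair _ _ _ (fun w => 3 * (eta (f w)).1) (fun w => 3 * (eta (f w)).2)); cont.
Qed.

Lemma flat_edge e s : flat (edgeX e s) = if e then eta3 (clamp s) else eta3 0.
Proof.
case: (edgeptP e s) => [[s0 ->]|[s1 ->]|[i -> ->]] /=; case: e => //.
- by rewrite clamp_le0.
- by rewrite clamp_ge1 // -[1]add0r eta3_1.
- by rewrite clamp_in //; have /andP[/ltW -> /ltW ->] := valP i.
Qed.

Lemma flat_bb s : 0 <= s <= 2 -> flat (bb s) = eta3 s.
Proof.
move=> /andP[s0 s2]; rewrite /bb /=; case: (lerP (s - 1) 0) => s1.
  by rewrite flat_edge clamp_in //; lra.
rewrite ifT; last lra.
by rewrite flat_edge clamp_in ?subr_ge0; [rewrite -[in RHS](subrK 1 s) eta3_1|lra].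
Qed.

Lemma flat_low x : -1 <= x <= 1 ->
  flat (walk edgeX v [:: ea; eb; ea] (3 * ((x + 1) / 2))) = eta3 (lower 0 x).
Proof.
move=> x1; rewrite /lower subr0 mul1r mul0r addr0 (_ : (3 * x + 1) / 2 = 3 * ((x + 1) / 2) - 1); last lra.
rewrite -(walk_push0 v) /=; move: (3 * _) => u; rewrite !push0.
case: (lerP (u - 1) 0) => u1.
  by rewrite flat_edge clamp_le0.
case: (lerP (u - 1 - 1) 0) => u2.
  by rewrite flat_edge.
rewrite clamp_ge1; last lra.
by rewrite -[1 in RHS]add0r eta3_1; case: ifP => _; [rewrite flat_edge|rewrite edgeX0 //; right].
Qed.

Lemma flat_cont : continuous flat.
Proof.
have cr := cont_rad; have c12 : 0 < 2^-1 :> R by lra.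
have cd := cont_dirx c12.
apply: cont_from_cells => [e|[]].
- rewrite (_ : (fun s => _) = (fun s => if e then eta3 (clamp s) else eta3 0)); last by apply/funext => s; rewrite flat_edge.
  by case: e; [apply: eta3_cont; apply: clamp_cont; cont|exact: cont_cst].
- pose tt z : R := 2 - 2 * Num.min 1 (rad z).
  have ct : continuous tt by rewrite /tt; cont.
  have inner z : rad z < 1 -> flat (faceX fW z) = flatW z.
    by move=> z1; case: (faceptP fW z) => [[]|[d -> ->]] //; rewrite leNgt z1.
  have t1 z : 1 <= rad z -> tt z = 0 by move=> z1; rewrite /tt min_l //; lra.
  have agree z : 0 <= rad z - 2^-1 -> z.2 = 0 -> eta3 (lower (tt z) (dirx 2^-1 z)) = eta3 (upper (tt z) (dirx 2^-1 z)).
    move=> z2 zz; have h : 2^-1 <= rad z by lra.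
    by have [->|->] := dirx_axis c12 h zz; [rewrite upper1 eta3_1|rewrite lowerN1].
  have half z : rad z = 2^-1 -> 6 *: z = eta3 (if z.2 <= 0 then lower (tt z) (dirx 2^-1 z) else upper (tt z) (dirx 2^-1 z)).
    move=> z2; rewrite /tt min_r z2; last lra.
    rewrite /lower /upper (_ : 2 - 2 * 2^-1 = 1); last lra.
    rewrite subrr !mul0r !add0r !mul1r /dirx z2 maxxx invrK.
    have e2 : eta (if z.2 <= 0 then turn (z.1 * 2) else 1 - turn (z.1 * 2)) = 2 *: z.
      rewrite -[RHS]eta_turn; last by rewrite radZ // z2 divff ?pnatr_eq0.
      by congr eta; rewrite /= pmulr_rle0 // mulrC.
    by rewrite /eta3 e2 scalerA; congr (_ *: _); lra.
  have ffE z : 0 <= rad z - 2^-1 ->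
      flatW z = eta3 (if z.2 <= 0 then lower (tt z) (dirx 2^-1 z) else upper (tt z) (dirx 2^-1 z)).
    move=> z2; rewrite /flatW; case: ifP => // z2'; apply: half; lra.
  have dirE z : 1 <= rad z -> dirx 1 z = dirx 2^-1 z.
    by move=> z1; rewrite !dirx_ge //; lra.
  have dirB z : 1 <= rad z -> -1 <= dirx 1 z <= 1.
    by move=> z1; rewrite dirx_ge //; exact: dirx_bound.
  apply: (@cont_glue R _ _ (fun z => rad z - 2^-1) snd _ (fun z => 6 *: z)
    (fun z => eta3 (lower (tt z) (dirx 2^-1 z))) (fun z => eta3 (upper (tt z) (dirx 2^-1 z)))).
  + by cont.
  + by cont.
  + by apply: (@cont_pair _ _ _ (fun w : R * R => 6 * w.1) (fun w => 6 * w.2)); cont.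
  + by apply: eta3_cont; exact: lower_cont.
  + by apply: eta3_cont; exact: upper_cont.
  + by move=> z z2; rewrite inner ?/flatW ?z2 //; lra.
  + move=> z z2 zz; case: (ltP (rad z) 1) => z1; first by rewrite inner // ffE // zz.
    by rewrite faceW_low // flat_low ?dirB // t1 // dirE.
  + move=> z z2 zz; case: (ltP (rad z) 1) => z1.
      rewrite inner // ffE //; case: ifP => // z0.
      by apply: agree => //; apply/eqP; rewrite eq_le z0.
    rewrite faceW_up // flat_bb; last by have := dirB _ z1; lra.
    by rewrite t1 // /upper subr0 mul1r mul0r addr0 dirE.
- rewrite (_ : (fun z => _) = (fun=> eta3 0)); first exact: cont_cst.
  apply/funext => z; case: (faceptP fA z) => [[z1 ->]|[d _ ->]] //.
  by rewrite attA; case: ifP => // _; rewrite flat_edge.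
Qed.

Lemma unroll_eta s : 0 <= s <= 2 -> unroll (eta3 s) = bb s.
Proof.
have G01 x : 0 <= x <= 1 -> unroll (eta3 x) = bb x.
  move=> /andP[s0 s1].
  have r3 : rad (eta3 x) = 3 by rewrite /eta3 radZ ?rad_eta ?mulr1.
  have dE : dirx 1 (eta3 x) = (eta x).1.
    by rewrite dirx_ge ?r3 ?ler1n // /eta3 dirxZ // dirx_unit // rad_eta.
  have e2 : (eta3 x).2 = 3 * (eta x).2 by [].
  have c1 : clamp (3 - 2 : R) = 1 by rewrite clamp_ge1; lra.
  case: (lerP x 2^-1) => s2.
    rewrite unroll_lowE ?r3; [|lra|by rewrite e2 pmulr_rle0 // eta_neg // s0].
    rewrite unroll_low2 ?r3; last lra.
    by rewrite dE c1 /lower subrr mul0r add0r mul1r turn_eta // s0.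
  have s2' : 2^-1 <= x <= 1 by rewrite ltW.
  rewrite unroll_upE ?r3; [|lra|by rewrite e2 mulr_ge0 // eta_pos].
  by rewrite /unroll_up r3 dE c1 /upper subrr mul0r add0r mul1r turn_eta'.
move=> /andP[s0 s2]; case: (lerP s 1) => s1; first by rewrite G01 // s0.
by rewrite -(subrK 1 s) eta3_1 bb1 ?G01 //; lra.
Qed.

(** On the outer half of W, [slide] at time 1 goes back through the radii from
    3 to 2, where [unroll] only depends on the position on the circle; this is
    the value of [unroll] on the circle of radius 3. *)
Lemma unroll_flat p : unroll (flat p) = slide p 1.
Proof.
have G0 : unroll (eta3 0) = v by rewrite unroll_eta ?lexx ?ler0n // bb_in ?ler01 // edgeX0 //; left.
case: (ptP p) => [[[] ->]|[e [i ->]]|[[] [d ->]]] //=.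
- rewrite push1; case: e => //; have := valP i => /=; move: (sval i) => r /andP[r0 r1].
  by rewrite unroll_eta ?bb_in //; lra.
- have := valP d => /= d1; rewrite /slideW /stretch subrr add0r mul1r /flatW.
  move: (sval d) d1 => z z1; rewrite subr_le0; case: lerP => z2.
    by congr unroll; congr (_ *: _); rewrite invrK; lra.
  have zp : 0 < rad z by lra.
  rewrite min_r ?(ltW z1) //.
  have sp : 0 < 4 / rad z - 2 by rewrite subr_gt0 ltr_pdivlMr //; lra.
  have rE : rad ((4 / rad z - 2) *: z) = 4 - 2 * rad z.
    by rewrite radZ ?ltW // mulrBl divfK // gt_eqF.
  have dE : dirx 1 ((4 / rad z - 2) *: z) = dirx 2^-1 z.
    by rewrite dirx_ge ?rE ?dirxZ // ?[RHS]dirx_ge //; lra.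
  have cE : clamp (4 - 2 * rad z - 2) = 2 - 2 * rad z by rewrite clamp_in; lra.
  have t01 : 0 <= 2 - 2 * rad z <= 1 by lra.
  case: ifP => zz.
    rewrite unroll_eta; last by have := lower_bound (dirx 2^-1 z) t01; lra.
    rewrite unroll_lowE ?rE; [|lra|by rewrite /= pmulr_rle0].
    by rewrite unroll_low2 ?rE ?dE ?cE //; lra.
  rewrite unroll_eta; last first.
    apply: upper_bound => //; rewrite dirx_ge; [exact: dirx_bound|exact: ltW].
  rewrite unroll_upE ?rE; [|lra|by rewrite /= mulr_ge0 // ltW // ltNge zz].
  by rewrite /unroll_up rE dE cE.
- rewrite /slideA subrr mul0r add0r mul1r faceA_top //.
Qed.

(** From the identity to [unroll] after [flat] by [slide], then to a constant
    by a linear contraction of the plane. *)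
Lemma abalone_contractible : contractible R T.
Proof.
pose H (pt : T * R) : T := if pt.2 - 2^-1 <= 0 then slide pt.1 (clamp (2 * pt.2)) else unroll ((2 - 2 * pt.2) *: flat pt.1).
exists (unroll 0), H; split.
- apply: continuous_subspaceT; apply: cont_if; first by cont.
  + apply: (@cont_comp _ _ _ (fun pt : T * R => (pt.1, 2 * pt.2)) _ _ slide_cont).
    by cont.
  + by apply: unroll_scale_cont; [cont|exact: cont_comp (@cont_fst _ _) flat_cont].
  + move=> [p t] /= t2; rewrite clamp_ge1; last lra.
    by rewrite (_ : 2 - 2 * t = 1) ?scale1r ?unroll_flat //; lra.
- by move=> p; rewrite /H /= mulr0 clamp_le0 // ifT ?slide0 //; lra.
- move=> p; rewrite /H /= ifF; last by apply/negbTE; rewrite -ltNge; lra.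
  by rewrite mulr1 subrr scale0r.
Qed.

End Contraction.

(** * Winding numbers *)

Section Winding.
Variable R : realType.
Implicit Types (p q : R * R) (a b : R).

Definition cmul p q : R * R := (p.1 * q.1 - p.2 * q.2, p.1 * q.2 + p.2 * q.1).
Definition dot p q : R := p.1 * q.1 + p.2 * q.2.
(** The signed clockwise angle from [p] to [q], in turns, when it is less than
    a right angle: the sine of the angle is the cross product, and [4^-1 -
    turn] is the arcsine. *)
Definition arc p q : R := 4^-1 - turn (p.2 * q.1 - p.1 * q.2).

Lemma etaD a b : eta (a + b) = cmul (eta a) (eta b).
Proof. by rewrite /eta /cmul /= mulrDl cosD sinD; congr (_, _); ring. Qed.

Lemma cmulA p q (r : R * R) : cmul p (cmul q r) = cmul (cmul p q) r.
Proof. by rewrite /cmul /=; congr (_, _); ring. Qed.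

Lemma cmul1 p : cmul p (eta 0) = p.
Proof. by rewrite eta0 /cmul /= !mulr1 !mulr0 subr0 add0r; case: p. Qed.

Lemma eta_quarter a : (eta (4^-1 - a)).1 = sin (a * (pi *+ 2)).
Proof.
rewrite /= (_ : (4^-1 - a) * _ = - (a * (pi *+ 2) - pi / 2)); last by rewrite -mulr_natr; lra.
by rewrite cosN cosBpihalf.
Qed.

Lemma eta_arc a : eta (4^-1 - a) = (sin (a * (pi *+ 2)), - cos (a * (pi *+ 2))).
Proof.
rewrite -eta_quarter /eta /=; congr (_, _).
rewrite (_ : (4^-1 - a) * _ = - (a * (pi *+ 2) - pi / 2)); last by rewrite -mulr_natr; lra.
by rewrite sinN sinBpihalf opprK.
Qed.

Lemma arcP p q : rad p = 1 -> rad q = 1 -> 0 < dot p q -> q = cmul p (eta (arc p q)).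
Proof.
move=> rp rq; rewrite /dot /arc.
have hp := sqr_rad p; have hq := sqr_rad q; rewrite rp expr1n in hp; rewrite rq expr1n in hq.
set c := p.2 * q.1 - p.1 * q.2; set d := p.1 * q.1 + p.2 * q.2 => d0.
have cd : c ^+ 2 + d ^+ 2 = 1.
  rewrite (_ : c ^+ 2 + d ^+ 2 = (p.1 ^+ 2 + p.2 ^+ 2) * (q.1 ^+ 2 + q.2 ^+ 2)); last by rewrite /c /d; ring.
  by rewrite -hp -hq mulr1.
have c1 : -1 <= c <= 1 by apply/andP; split; nra.
rewrite eta_arc /turn divfK ?pi2_neq0 // min_r; last by case/andP: c1.
rewrite max_r; last by case/andP: c1.
rewrite acosK // sin_acos // (_ : 1 - c ^+ 2 = d ^+ 2); last lra.
rewrite sqrtr_sqr gtr0_norm // /cmul /c /d /= [LHS]surjective_pairing; congr (_, _).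
  rewrite (_ : _ - _ = q.1 * (p.1 ^+ 2 + p.2 ^+ 2)); last by ring.
  by rewrite -hp mulr1.
rewrite (_ : _ + _ = q.2 * (p.1 ^+ 2 + p.2 ^+ 2)); last by ring.
by rewrite -hp mulr1.
Qed.

Lemma arc_eta a b : - 4^-1 <= b - a <= 4^-1 -> arc (eta a) (eta b) = b - a.
Proof.
move=> /andP[h1 h2]; rewrite /arc.
have -> : (eta a).2 * (eta b).1 - (eta a).1 * (eta b).2 = (eta (4^-1 - (b - a))).1.
  by rewrite eta_quarter mulrBl sinB /=; ring.
by rewrite turn_eta; lra.
Qed.

Lemma arc_cont (S : topologicalType) (f g : S -> R * R) :
  continuous f -> continuous g -> continuous (fun w => arc (f w) (g w)).
Proof.
move=> cf cg.
have f1 := cont_comp cf (@cont_fst _ _); have f2 := cont_comp cf (@cont_snd _ _).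
have g1 := cont_comp cg (@cont_fst _ _); have g2 := cont_comp cg (@cont_snd _ _).
rewrite /arc; apply: contD; first by cont.
by apply: contN; apply: (cont_comp _ turn_cont); cont.
Qed.

(** Cut the parameter interval so finely that consecutive points of each loop
    of the homotopy are less than a right angle apart. The sum of the angles
    between them is continuous in the loop, an integer because the loop closes
    up, 1 for the first loop and 0 for the constant one. *)
Lemma loop_essential (H : R * R -> R * R) : continuous H -> (forall w, rad (H w) = 1) ->
  (forall s, 0 <= s <= 1 -> H (s, 0) = eta (clamp (4 * s - 3))) ->
  (forall s, 0 <= s <= 1 -> H (s, 1) = eta 0) ->
  (forall t, 0 <= t <= 1 -> H (0, t) = eta 0 /\ H (1, t) = eta 0) -> False.
Proof.
move=> cH rH H0 H1 Hb.
have [r r0 small] : exists2 r : R, 0 < r & forall d, `|d| < r -> forall s t, 0 <= s <= 1 -> 0 <= t <= 1 ->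
    0 < dot (H (s, t)) (H (s + d, t)).
  have cI : compact (`[(0 : R), 1]%classic `*` `[(0 : R), 1]%classic).
    by apply: compact_setX; exact: segment_compact.
  pose P (d : R) (w : R * R) := 0 < dot (H w) (H (w.1 + d, w.2)).
  have cP : continuous (fun wd : (R * R) * R => - dot (H wd.1) (H (wd.1.1 + wd.2, wd.1.2))).
    have f1 : continuous (fun wd : (R * R) * R => H wd.1) by apply: cont_comp (@cont_fst _ _) cH.
    have f2 : continuous (fun wd : (R * R) * R => H (wd.1.1 + wd.2, wd.1.2)).
      apply: (cont_comp (f := fun wd : (R * R) * R => (wd.1.1 + wd.2, wd.1.2)) _ cH).
      have h1 := cont_comp (@cont_fst (R * R)%type R) (@cont_fst _ _).
      have h2 := cont_comp (@cont_fst (R * R)%type R) (@cont_snd _ _).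
      by cont.
    have a1 := cont_comp f1 (@cont_fst _ _); have a2 := cont_comp f1 (@cont_snd _ _).
    have b1 := cont_comp f2 (@cont_fst _ _); have b2 := cont_comp f2 (@cont_snd _ _).
    by rewrite /dot; cont.
  have := (compact_near_coveringP _).1 cI R (nbhs (0 : R)) P _; move=> near_P.
  have : \forall d \near nbhs (0 : R), `[(0 : R), 1]%classic `*` `[(0 : R), 1]%classic `<=` P d.
    apply: near_P => w _.
    have : nbhs (w, 0 : R) [set wd : (R * R) * R | - dot (H wd.1) (H (wd.1.1 + wd.2, wd.1.2)) < 0].
      apply: open_nbhs_nbhs; split; first exact: (open_sublevel _ cP).
      rewrite /= addr0 oppr_lt0 -surjective_pairing /dot -!expr2 -sqr_rad rH expr1n //.
    move=> [[A B] [/= Aw B0] AB]; exists (A, B) => //= -[w' d] [/= Aw' Bd].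
    by have := AB (w', d) (conj Aw' Bd); rewrite /= oppr_lt0.
  move=> /nbhs_ballP [r /= r0 rP]; exists r => // d dr s t s01 t01.
  apply: (rP d _ (s, t)); first by rewrite /ball /= sub0r normrN.
  by rewrite /= !in_itv.
(* Steps shorter than [r] keep the angles acute; 16 steps at least, so that the
   first loop, which makes its turn in the last quarter of the time, advances by
   at most a quarter turn in each. *)
pose n := (Num.trunc r^-1 + 16)%N.
have n0 : (0 : R) < n%:R by rewrite ltr0n addn_gt0 orbT.
have n16 : (16 : R) <= n%:R by rewrite ler_nat leq_addl.
have nr : n%:R^-1 < r.
  rewrite invf_plt ?posrE //; apply: (lt_le_trans (truncnS_gt _)).
  by rewrite ler_nat /n -addn1 leq_add2l.
pose x (k : nat) : R := k%:R / n%:R.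
have x01 k : (k <= n)%N -> 0 <= x k <= 1.
  by move=> kn; rewrite /x divr_ge0 ?ler0n //= ler_pdivrMr // mul1r ler_nat.
have xS k : x k.+1 = x k + n%:R^-1 by rewrite /x -natr1 mulrDl mul1r.
have xn : x n = 1 by rewrite /x divff // gt_eqF.
pose W k t := \sum_(0 <= j < k) arc (H (x j, t)) (H (x j.+1, t)).
have WE t k : 0 <= t <= 1 -> (k <= n)%N -> H (x k, t) = cmul (H (0, t)) (eta (W k t)).
  move=> t01; elim: k => [_|k IH kn].
    by rewrite /W big_geq // cmul1 /x mul0r.
  rewrite /W big_nat_recr //= etaD cmulA -IH ?(ltnW kn) //.
  apply: arcP => //; rewrite xS; apply: small => //; last by rewrite x01 // ltnW.
  by rewrite gtr0_norm ?invr_gt0.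
have etaW t : 0 <= t <= 1 -> eta (W n t) = eta 0.
  move=> t01; have := WE t n t01 (leqnn n); rewrite xn; have [-> ->] := Hb t t01.
  by move=> ->; rewrite -etaD add0r.
have cW : continuous (W n).
  apply: cont_sum => j.
  by apply: arc_cont; [apply: (cont_comp (f := fun t => (x j, t)) _ cH)|
    apply: (cont_comp (f := fun t => (x j.+1, t)) _ cH)]; cont.
have W0 : W n 0 = 1.
  have -> : W n 0 = \sum_(0 <= j < n) (clamp (4 * x j.+1 - 3) - clamp (4 * x j - 3)).
    apply: eq_big_nat => i /andP[_ jn]; rewrite !H0 ?x01 ?(ltnW jn) // arc_eta // xS.
    have : 0 < n%:R^-1 :> R by rewrite invr_gt0.
    have : n%:R^-1 <= 16^-1 :> R by rewrite lef_pV2 ?posrE.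
    move: (n%:R^-1) (x i) => e y e1 e0; rewrite /clamp.
    have m1 : Num.min 1 (4 * y - 3) <= Num.min 1 (4 * (y + e) - 3) <= Num.min 1 (4 * y - 3) + 4 * e.
      by case: (lerP 1 (4 * y - 3)) => ?; case: (lerP 1 (4 * (y + e) - 3)) => ?; lra.
    move: m1; move: (Num.min _ _) (Num.min _ _) => u u' m1.
    by case: (lerP 0 u) => ?; case: (lerP 0 u') => ?; lra.
  rewrite telescope_sumr // xn /x mul0r clamp_ge1; last lra.
  by rewrite clamp_le0; lra.
have W1 : W n 1 = 0.
  rewrite /W big_nat big1 // => i /andP[_ jn]; rewrite !H1 ?x01 ?(ltnW jn) // arc_eta ?subrr //.
  by lra.
(* At an intermediate loop the sum would be a half turn, and the loop would not
   close up. *)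
have [|t t01 Wt] := @IVT R (W n) 0 1 2^-1 ler01 (continuous_subspaceT cW).
  by rewrite W0 W1 le_max ge_min; apply/andP; split; apply/orP; [right|left]; lra.
rewrite in_itv /= in t01.
have := etaW t t01; rewrite Wt eta0 /eta (_ : 2^-1 * (pi *+ 2) = pi); last by rewrite -mulr_natr; lra.
by rewrite cospi => -[]; lra.
Qed.

End Winding.

(** * A loop that is not null-homotopic *)

Section Sphere_pi1.
Variable R : realType.
Let K := sphere_data unit.
Local Notation T := (realization K R).
Local Notation v0 := ((false, false) : vert K).

(** The sphere is collapsed to a point, and the additional edge becomes the
    circle. *)
Definition unwrap (p : T) : R * R :=
  if p is inl (inr (inr _, i)) then eta (val i) else eta 0.

Lemma unwrap_edge e s : unwrap (edgept e s) = if e is inr _ then eta (clamp s) else eta 0.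
Proof.
case: (edgeptP e s) => [[s0 ->]|[s1 ->]|[i -> ->]] /=; case: e => //.
- by rewrite clamp_le0.
- by rewrite clamp_ge1 // -[1]add0r eta1.
- by rewrite clamp_in //; have /andP[/ltW -> /ltW ->] := valP i.
Qed.

Lemma unwrap_cont : continuous unwrap.
Proof.
apply: cont_from_cells => [e|f].
  rewrite (_ : (fun s => _) = (fun s => if e is inr _ then eta (clamp s) else eta 0)).
    by case: e => _; [exact: cont_cst|apply: eta_cont; apply: clamp_cont; cont].
  by apply/funext => s; rewrite unwrap_edge.
have path p es u : unwrap p = eta 0 -> all (fun e => if e is inr _ then false else true) es ->
    unwrap (walk (@edgept K R) p es u) = eta 0.
  elim: es p u => //= e es IH p u p0 /andP[e0 es0].
  by case: ifP => _; [|apply: IH => //]; rewrite unwrap_edge; case: e e0.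
rewrite (_ : (fun z => _) = (fun=> eta 0)); first exact: cont_cst.
apply/funext => z; case: (faceptP f z) => [[z1 ->]|[d _ ->]] //.
by rewrite /att /bigon; case: ifP => _; apply: path => //; case: f => [[] []].
Qed.

Definition equator : seq (edge K) :=
  [:: inl (inr (Some false)); inl (inr None); inl (inr (Some true)); inr tt].

(** Through the sphere from [v0] to [v3] along the edges b, then back along
    the additional edge. *)
Definition around (s : R) : T := walk (@edgept K R) (Vx R v0) equator (4 * s).

Lemma around_linked : linked (@edgept K R) (Vx R v0) equator.
Proof. by apply: chain_linked. Qed.

Lemma around_cont : continuous around.
Proof.
apply: (@walk_cont R _ R T (fun _ => @edgept K R) equator (fun _ => Vx R v0)).
- by move=> e; apply: (cont_comp (@cont_snd _ _)); exact: edgept_cont.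
- exact: cont_cst.
- by cont.
- by move=> _; exact: around_linked.
Qed.

Lemma unwrap_around s : s <= 1 -> unwrap (around s) = eta (clamp (4 * s - 3)).
Proof.
move=> s1; rewrite /around /=.
case: ifP => h1; first by rewrite unwrap_edge clamp_le0 //; lra.
case: ifP => h2; first by rewrite unwrap_edge clamp_le0 //; lra.
case: ifP => h3; first by rewrite unwrap_edge clamp_le0 //; lra.
rewrite ifT; last lra.
by rewrite unwrap_edge; congr (eta (clamp _)); lra.
Qed.

Lemma rad_unwrap p : rad (unwrap p) = 1.
Proof. by case: p => [[v|[[e|z] i]]|fd] /=; exact: rad_eta. Qed.

Lemma sphere_pi1 : ~ pi1_trivial R T.
Proof.
move=> /(_ (Vx R v0)) pi1E.
have lp : loop (Vx R v0) around.
  split; first exact: continuous_subspaceT around_cont.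
    by rewrite /around mulr0 walk0 //; exact: around_linked.
  rewrite /around mulr1 -[4]/((size equator)%:R : R) walk_size //; last exact: around_linked.
  by rewrite /walk_end /= edgept1.
have : pi1 (Vx R v0) (loop_class (Vx R v0) around) by exists around.
rewrite pi1E /= => cE.
have : loop_class (Vx R v0) (fun=> Vx R v0) (fun _ : R => Vx R v0).
  split; first by split=> //; apply: continuous_subspaceT; exact: cont_cst.
  exists (fun=> Vx R v0); split=> //.
  by apply: continuous_subspaceT; exact: cont_cst.
rewrite -cE => -[_ [H [cH H0 H1 Hb]]].
have inI (t : R) : unit_interval R (clamp t) by rewrite /unit_interval /= in_itv /= clamp_bound.
pose c (w : R * R) := (clamp w.1, clamp w.2).
have cc : continuous c by apply: cont_pair; apply: clamp_cont; cont.
have cHc : continuous (fun w => H (c w)).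
  move=> w A.
  move/subspace_continuousP: cH => /(_ (c w)) cH /cH /= wA.
  have /wA : (unit_interval R `*` unit_interval R) (c w) by split; exact: inI.
  move=> {}wA; have := cc w _ wA; rewrite /= nbhs_simpl /=; apply: filterS => y; apply.
  by split; exact: inI.
have u0 : unwrap (Vx R v0) = eta 0 by [].
have c0 : clamp (0 : R) = 0 by rewrite clamp_le0.
have c1 : clamp (1 : R) = 1 by rewrite clamp_ge1.
have I01 (t : R) : 0 <= t <= 1 -> unit_interval R t by move=> t01; rewrite /unit_interval /= in_itv.
apply: (@loop_essential R (fun w => unwrap (H (c w)))).
- exact: cont_comp cHc unwrap_cont.
- by move=> w; exact: rad_unwrap.
- move=> s s01; rewrite /c /= c0 clamp_in // H0; last exact: I01.
  by rewrite unwrap_around //; case/andP: s01.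
- by move=> s s01; rewrite /c /= c1 clamp_in // H1 //; exact: I01.
- move=> t t01; rewrite /c /= c0 c1 clamp_in //.
  by have [-> ->] := Hb t (I01 t t01).
Qed.

End Sphere_pi1.

(** * The abalone has neither property *)

Theorem mainTheorem1 (R : realType) :
  exists X : complex2 R, contractible R X /\ ~ NPI X /\ ~ WNPI X.
Proof.
exists (complex_of abalone R); split; first exact: abalone_contractible.
split=> [npi|wnpi].
  have imm := @sphere_immersion unit R (fun z z' => match z, z' with tt, tt => erefl end).
  case: (npi _ _ imm (@sphere_compact unit R) (@sphere_connected unit R)); last exact: sphere_pi1.
  by rewrite sphere_euler card_unit.
have := wnpi (complex_of (sphere_data void) R) (@sphere_map void R).
rewrite sphere_euler card_void subr0 => h.
suff : (2 : int) <= 1 by [].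
apply: h; [by apply: sphere_immersion => -[]|exact: sphere_compact|exact: sphere_connected].
Qed.
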